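(* Let $U\subset\mathbb R^n$ be an open set. Then $\mathrm{BV}(U) = \mathrm{BV}^0(U)$. Indeed, if $u \in L^1(U)$, then \[\mathbf V^0(u) \leq \mathbf V(u) \leq 2n\,\mathbf V^0(u).\]
   Context: $n\ge1$. For a function $f:U\to\mathbb R$ and $\alpha\in[0,1]$, $\mathrm{Lip}^\alpha(f)=\sup_{x\ne y}|f(x)-f(y)|/|x-y|^\alpha$ (so $\mathrm{Lip}^0(f)=\sup_{x, y}|f(x)-f(y)|$), and $\mathrm{Lip}=\mathrm{Lip}^1$; $\mathrm{Lip}(U)$ is the set of real Lipschitz functions on $U$ and $\mathrm{Lip}_c(U)$ those with compact support in $U$. For $u\in L^1(U)$, $\mathbf V^\alpha(u)=\sup\bigl|\int_U u(x)\det D(f,g^1,\dots,g^{n-1})_x\,dx\bigr|$, the supremum over all $(f,g^1,\dots,g^{n-1})\in\mathrm{Lip}_c(U)\times\mathrm{Lip}(U)^{n-1}$ with $\mathrm{Lip}^\alpha(f)\le1$ and $\mathrm{Lip}(g^i)\le1$ for all $i$; $\mathrm{BV}^\alpha(U)=\{u\in L^1(U):\mathbf V^\alpha(u)<\infty\}$. $\mathbf V(u)=\sup\{\int_U u\operatorname{div}\varphi\,dx:\varphi\in C^1_c(U,\mathbb R^n),\|\varphi\|_\infty\le1\}$ and $\mathrm{BV}(U)=\{u\in L^1(U):\mathbf V(u)<\infty\}$. *)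

(* Defs.v *)
From HB Require Import structures.
From mathcomp Require Import all_boot all_order all_algebra.
From mathcomp Require Import all_classical all_reals all_analysis.

Set Implicit Arguments.
Unset Strict Implicit.
Unset Printing Implicit Defensive.

Import Order.TTheory GRing.Theory Num.Theory.
Import numFieldNormedType.Exports.

Local Open Scope classical_set_scope.
Local Open Scope ring_scope.

Fact rV_display : measure_display. Proof. exact: default_measure_display. Qed.

Section measurable_rV.
Context {R : realType} (n : nat).

(* The sigma-algebra generated by the coordinates, i.e. the Borel sigma-algebra
   of R^n. *)
Let coords : 'I_n -> 'rV[R]_n -> measurableTypeR R := fun i x => x ord0 i.

Let rV_set0 : g_sigma_preimage coords set0.
Proof. exact: sigma_algebra0. Qed.

Let rV_setC A : g_sigma_preimage coords A -> g_sigma_preimage coords (~` A).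
Proof. exact: sigma_algebraC. Qed.

Let rV_bigcup (F : _^nat) : (forall i, g_sigma_preimage coords (F i)) ->
  g_sigma_preimage coords (\bigcup_i (F i)).
Proof. exact: sigma_algebra_bigcup. Qed.

HB.instance Definition _ := @isMeasurable.Build rV_display
  'rV[R]_n (g_sigma_preimage coords) rV_set0 rV_setC rV_bigcup.

Lemma measurable_coord (i : 'I_n) :
  measurable_fun [set: 'rV[R]_n] (fun x => x ord0 i : measurableTypeR R).
Proof.
move=> _ Y mY; rewrite setTI; apply: sub_sigma_algebra => /=.
rewrite -bigcup_seq/=; exists i => /=; first by rewrite mem_index_enum.
by exists Y => //; rewrite setTI.
Qed.

Lemma measurable_rVP d (T : measurableType d) (f : T -> 'rV[R]_n) :
  (forall i, measurable_fun setT (fun t => f t ord0 i : measurableTypeR R)) ->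
  measurable_fun setT f.
Proof.
move=> mf; suff h : g_sigma_preimage (fun i => coords i \o f) `<=` measurable.
  rewrite g_sigma_preimage_comp in h.
  by move=> _ A mA; apply: h; exists A.
apply: smallest_sub; first exact: sigma_algebra_measurable.
case: n f mf @coords => [|m] f mf c; first by rewrite big_ord0.
rewrite -bigcup_mkord_ord; apply: bigcup_sub => i Ii.
by move=> A [B mB <-]; exact: mf.
Qed.

End measurable_rV.

Section lebesgue_cons.
Context {R : realType} (n : nat).

Definition cons_rV (p : measurableTypeR R * 'rV[R]_n) : 'rV[R]_n.+1 :=
  row_mx (p.1 : R)%:M p.2.

Lemma cons_rV0 p : cons_rV p ord0 ord0 = p.1.
Proof.
rewrite /cons_rV.
have -> : (ord0 : 'I_n.+1) = lshift n (ord0 : 'I_1) by exact: val_inj.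
by rewrite (@row_mxEl _ 1 1 n) mxE mulr1n.
Qed.

Lemma cons_rVS p i : cons_rV p ord0 (lift ord0 i) = p.2 ord0 i.
Proof.
rewrite /cons_rV (_ : lift ord0 i = rshift 1 i); last exact: val_inj.
by rewrite (@row_mxEr _ 1 1 n).
Qed.

Lemma measurable_cons_rV : measurable_fun setT cons_rV.
Proof.
apply: measurable_rVP => i; have [j ->|->] := unliftP ord0 i.
  under eq_fun do rewrite cons_rVS.
  exact: (measurableT_comp (measurable_coord j) measurable_snd).
by under eq_fun do rewrite cons_rV0; exact: measurable_fst.
Qed.

HB.instance Definition _ :=
  isMeasurableFun.Build _ _ _ _ cons_rV measurable_cons_rV.

Variable mu : {sigma_finite_measure set 'rV[R]_n -> \bar R}.

Definition lebesgue_cons : set 'rV[R]_n.+1 -> \bar R :=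
  pushforward (@lebesgue_measure R \x mu)%E cons_rV.

Let lebesgue_cons0 : lebesgue_cons set0 = 0%E.
Proof. by rewrite /lebesgue_cons /pushforward preimage_set0 measure0. Qed.

Let lebesgue_cons_ge0 A : (0 <= lebesgue_cons A)%E.
Proof. exact: measure_ge0. Qed.

Let lebesgue_cons_sigma_additive : semi_sigma_additive lebesgue_cons.
Proof.
exact: measure_semi_sigma_additive.
Qed.

HB.instance Definition _ := isMeasure.Build _ _ _ lebesgue_cons
  lebesgue_cons0 lebesgue_cons_ge0 lebesgue_cons_sigma_additive.

Lemma lebesgue_consE (A : set (measurableTypeR R)) (B : set 'rV[R]_n) :
  measurable A -> measurable B ->
  lebesgue_cons [set x | A (x ord0 ord0) /\ B (\row_i x ord0 (lift ord0 i))] =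
  (lebesgue_measure A * mu B)%E.
Proof.
move=> mA mB; rewrite -product_measure1E//; congr product_measure1.
have tlK p : \row_i cons_rV p ord0 (lift ord0 i) = p.2.
  by apply/rowP => i; rewrite mxE cons_rVS.
by apply/funext => -[a x]; rewrite /preimage/= cons_rV0 tlK.
Qed.

Let lebesgue_cons_sigma_finite : sigma_finite setT lebesgue_cons.
Proof.
have /sigma_finiteP[F [TF ndF Foo]] := sigma_finiteT (@lebesgue_measure R).
have /sigma_finiteP[G [TG ndG Goo]] := sigma_finiteT mu.
exists (fun k =>
  [set x : 'rV[R]_n.+1 | F k (x ord0 ord0) /\ G k (\row_i x ord0 (lift ord0 i))]).
  apply/esym/seteqP; split=> // x _.
  have [i _ Fi] : (\bigcup_i F i) (x ord0 ord0) by rewrite -TF.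
  have [j _ Gj] : (\bigcup_i G i) (\row_i x ord0 (lift ord0 i)) by rewrite -TG.
  exists (maxn i j) => //; split.
  - by move: Fi; exact/subsetPset/ndF/leq_maxl.
  - by move: Gj; exact/subsetPset/ndG/leq_maxr.
move=> k; have [mF Fk] := Foo k; have [mG Gk] := Goo k; split.
  apply: measurableI.
    by rewrite -[X in measurable X]setTI; exact: measurable_coord.
  rewrite -[X in measurable X]setTI; apply: measurable_rVP => // i.
  by under eq_fun do rewrite mxE; exact: measurable_coord.
by rewrite lebesgue_consE// lte_mul_pinfty// ge0_fin_numE.
Qed.

HB.instance Definition _ := Measure_isSigmaFinite.Build _ _ _ lebesgue_cons
  lebesgue_cons_sigma_finite.

End lebesgue_cons.

(* Lebesgue measure on R^n as an iterated product; its value on boxes is given by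
   lebesgue_rVE. *)
Fixpoint lebesgue_rV (R : realType) (n : nat) :
    {sigma_finite_measure set 'rV[R]_n -> \bar R} :=
  if n is m.+1 then lebesgue_cons (lebesgue_rV R m) else \d_(0 : 'rV[R]_0).

Lemma lebesgue_rVE (R : realType) (n : nat)
    (A : 'I_n -> set (measurableTypeR R)) :
  (forall i, measurable (A i)) ->
  lebesgue_rV R n [set x | forall i, A i (x ord0 i)] =
  (\prod_(i < n) lebesgue_measure (A i))%E.
Proof.
elim: n A => [|n IH] A mA /=.
  rewrite big_ord0 diracE mem_set//= => -[].
  by [].
rewrite big_ord_recl -IH// -lebesgue_consE//.
  congr (lebesgue_cons _ _); apply/seteqP; split=> x /=.
    by move=> Ax; split=> // i; rewrite mxE.
  by case=> A0 AS i; have [j ->|->//] := unliftP ord0 i; have := AS j; rewrite mxE.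
rewrite (_ : mkset _ = \bigcap_i [set x | A (lift ord0 i) (x ord0 i)]).
  apply: fin_bigcap_measurable => // i _.
  by rewrite -[X in measurable X]setTI; exact: measurable_coord.
by apply/seteqP; split=> x /= Ax i; [move=> _|]; exact: Ax.
Qed.

Section definitions.
Context {R : realType} {n : nat}.
Implicit Types (U : set 'rV[R]_n.+1) (f u : 'rV[R]_n.+1 -> R).

(* The library norm on 'rV[R]_n is the sup norm. *)
Definition enorm (m : nat) (x : 'rV[R]_m) : R :=
  Num.sqrt (\sum_(i < m) x ord0 i ^+ 2).

Definition lip (a : R) U f : \bar R :=
  ereal_sup [set (`|f p.1 - f p.2| / enorm (p.1 - p.2) `^ a)%:E |
              p in [set p | [/\ U p.1, U p.2 & p.1 != p.2]]].

Definition compactly_supported (V : zmodType) U (f : 'rV[R]_n.+1 -> V) :=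
  let supp := closure [set x | U x /\ f x != 0] in
  compact supp /\ supp `<=` U.

(* Functions on U are represented by total functions; only their values on U
   matter. *)
Definition Lip U : set ('rV[R]_n.+1 -> R) := [set f | (lip 1 U f < +oo)%E].

Definition Lip_c U : set ('rV[R]_n.+1 -> R) :=
  [set f | Lip U f /\ compactly_supported U f].

(* Borel representatives of the classes in L^1(U). *)
Definition L1 U : set ('rV[R]_n.+1 -> R) :=
  [set u | (lebesgue_rV R n.+1).-integrable U (EFin \o u)].

(* The map (f, g^1, ..., g^n) into R^(n+1). *)
Definition cons_fun f (g : 'I_n -> 'rV[R]_n.+1 -> R) (x : 'rV[R]_n.+1) :
    'rV[R]_n.+1 :=
  \row_j oapp (g ^~ x) (f x) (unlift ord0 j).

(* 'J is the matrix of the differential in the row-vector convention, hence the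
   transpose of the usual Jacobian matrix; by Rademacher's theorem the
   differential exists almost everywhere on U for Lipschitz functions, so its
   default value elsewhere is irrelevant to the integral. *)
Definition varBValpha (a : R) U u : \bar R :=
  ereal_sup [set (`| \int[lebesgue_rV R n.+1]_(x in U)
                      (u x * \det ('J (cons_fun fg.1 fg.2) x))%R%:E |)%E |
    fg in [set fg : ('rV[R]_n.+1 -> R) * ('I_n -> 'rV[R]_n.+1 -> R) |
      [/\ Lip_c U fg.1, forall i, Lip U (fg.2 i),
          (lip a U fg.1 <= 1)%E & forall i, (lip 1 U (fg.2 i) <= 1)%E]]].

Definition BValpha (a : R) U : set ('rV[R]_n.+1 -> R) :=
  [set u | L1 U u /\ (varBValpha a U u < +oo)%E].

Definition C1_c U : set ('rV[R]_n.+1 -> 'rV[R]_n.+1) :=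
  [set phi | [/\ forall x, U x -> differentiable phi x,
                 forall x, U x -> {for x, continuous (fun y => 'J phi y)} &
                 compactly_supported U phi]].

Definition divergence (phi : 'rV[R]_n.+1 -> 'rV[R]_n.+1) (x : 'rV[R]_n.+1) : R :=
  \sum_(i < n.+1) 'D_(delta_mx ord0 i) (fun y => phi y ord0 i) x.

Definition varBV U u : \bar R :=
  ereal_sup [set (\int[lebesgue_rV R n.+1]_(x in U)
                    (u x * divergence phi x)%R%:E)%E |
    phi in [set phi | C1_c U phi /\ forall x, U x -> enorm (phi x) <= 1]].

Definition BV U : set ('rV[R]_n.+1 -> R) :=
  [set u | L1 U u /\ (varBV U u < +oo)%E].

End definitions.

(* Main.v *)
(* For the first inequality, extend f by zero and each g^k by McShane's formula
   to Lipschitz functions on the whole space, and average them over small segments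
   in each coordinate direction (twice). The averages f_h, g_h are C^2, and the
   field phi = f_h * cof(Dg_h), where cof(Dg_h) is dual to dg_h^1 /\ ... /\ dg_h^n,
   is C^1 with compact support in U; it satisfies |phi| <= 1 by Hadamard's
   inequality, as |f| <= 1 and |grad g_h^k| <= 1, and div phi = det D(f_h, g_h)
   since second derivatives commute. By Rademacher's theorem D(f_h, g_h) converges
   to D(f, g) almost everywhere, and dominated convergence concludes.

   For the second one, d_i phi_i is up to sign the determinant of the differential
   of (phi_i, the other coordinates), and phi_i has oscillation at most 2. *)

Require Import Defs.
From HB Require Import structures.
From mathcomp Require Import all_boot all_order all_algebra fingroup perm.
From mathcomp Require Import all_classical all_reals all_analysis.
From mathcomp Require Import lra.
Import Order.TTheory GRing.Theory Num.Theory.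
Import numFieldNormedType.Exports.
Local Open Scope classical_set_scope.
Local Open Scope ring_scope.

(** * Row vectors *)

(** Averages over segments stand in for a convolution. They commute with translations, so the bounds
    |f| <= 1 and Lip(g^k) <= 1, the latter for the Euclidean norm, pass to the averages unchanged,
    and the first inequality loses no constant. The derivative of an average in its own direction is
    a difference quotient; second derivatives then commute simply because difference quotients do.
    The averages reach only a multiple of h away, so the field keeps its support in U once h is
    small compared with the distance from the support of f to the complement of U. The bound |f| <=
    1 itself comes from Lip^0(f) <= 1 and a zero of f in U, which exists because a nonempty open set
    is not compact. Extending f by zero, rather than working on U, also removes any need for U to be
    convex. In Rademacher's theorem the obstacle is that the slopes in the first direction and in
    the others are controlled at one base point only, whereas an increment in both directions passes
    through a second one. Measurability is kept at hand by working with countable combinations of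
    closed sets. *)

Lemma lipschitz_continuous {R : realType} (V W : normedModType R) (f : V -> W) (L : R) :
  (forall x y, `|f x - f y| <= L * `|x - y|) -> continuous f.
Proof.
move=> fL x; apply/cvgrPdist_le => e e0.
have M0 : 0 < `|L| + 1 by rewrite ltr_wpDl.
near=> y; apply: (le_trans (fL _ _)).
rewrite (@le_trans _ _ ((`|L| + 1) * `|x - y|)) ?ler_wpM2r//.
  by rewrite (le_trans (ler_norm L))// lerDl.
rewrite -ler_pdivlMl//; near: y; apply: cvgr_dist_le; first exact: cvg_id.
by rewrite mulr_gt0 ?invr_gt0.
Unshelve. all: by end_near. Qed.

Section row_vectors.
Context {R : realType} {n : nat}.
Implicit Types x y z : 'rV[R]_n.

Lemma normrV_leP x (r : R) : 0 <= r ->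
  (`|x| <= r) <-> (forall i, `|x ord0 i| <= r).
Proof.
move=> r0; rewrite [`|x|]mx_normrE; split=> [xr i|xr].
  by apply: le_trans xr; apply: (le_bigmax _ _ (ord0, i)).
by apply/bigmax_leP; split=> // -[i j] _ /=; rewrite ord1.
Qed.

Lemma normrV_coord x i : `|x ord0 i| <= `|x|.
Proof. by move: i; apply/normrV_leP. Qed.

Lemma continuous_coord i : continuous (fun x : 'rV[R]_n => x ord0 i).
Proof. by move=> x; apply: differentiable_continuous; exact: differentiable_coord. Qed.

(** The sigma-algebra is generated by the coordinates, so rational boxes are measurable, and an open
    set is the union of the countably many rational boxes that it contains. *)
Lemma open_measurable_rV (A : set 'rV[R]_n) : open A -> measurable A.
Proof.
move=> oA.
pose box (p : 'rV[rat]_n * nat) : set 'rV[R]_n :=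
  \bigcap_(i : 'I_n) [set x | `|x ord0 i - ratr (p.1 ord0 i)| < p.2.+1%:R^-1].
have mbox p : measurable (box p).
  apply: fin_bigcap_measurable => // i _.
  rewrite -[X in measurable X]setTI.
  apply: (measurable_coord i measurableT
    (Y := [set t : R | `|t - ratr (p.1 ord0 i)| < p.2.+1%:R^-1])).
  rewrite (_ : mkset _ = ball (ratr (p.1 ord0 i) : R) p.2.+1%:R^-1).
    exact: measurable_realfun.measurable_ball.
  by apply/seteqP; split=> t; rewrite -ball_normE/= distrC.
have -> : A = \bigcup_(p in [set p | box p `<=` A]) box p.
  apply/seteqP; split=> [x Ax|x [p /= pA]]; last exact: pA.
  have /nbhs_ballP[e /= e0 xeA] : nbhs x A by exact: open_nbhs_nbhs.
  pose k := Num.bound (2 / e).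
  have ke : k.+1%:R^-1 < e / 2 :> R.
    rewrite -[ltRHS]invrK ltf_pV2 ?posrE ?invr_gt0 ?divr_gt0// invf_div.
    by rewrite (lt_le_trans (unstable.ltr_bound _))// ler_nat.
  have q_ex i : exists q : rat, `|x ord0 i - ratr q| < k.+1%:R^-1.
    have [] := @rat_in_itvoo R (x ord0 i - k.+1%:R^-1) (x ord0 i + k.+1%:R^-1).
      by rewrite ltrBlDr -addrA ltrDl addr_gt0 ?invr_gt0.
    move=> q; rewrite in_itv/= => /andP[q1 q2]; exists q.
    by rewrite distrC ltr_distl q1 q2.
  pose q : 'rV[rat]_n := \row_i sval (cid (q_ex i)).
  exists (q, k) => /=; last by move=> i _ /=; rewrite mxE; case: cid.
  move=> y yq; apply: xeA; rewrite -ball_normE/=.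
  rewrite (@le_lt_trans _ _ (2 * k.+1%:R^-1))//; last first.
    by move: ke; set a := (_^-1); lra.
  apply/normrV_leP => [|i]; first by rewrite mulr_ge0 ?invr_ge0.
  have := yq i I; rewrite /= !mxE; case: cid => qi /= xq yqi.
  apply: le_trans (ler_distD (ratr qi) _ _) _.
  by rewrite (distrC (ratr qi)) mulr_natl mulr2n lerD// ltW.
rewrite bigcup_mkcond; apply: countable_bigcupT_measurable => [|p].
  exact: countableP.
by case: ifP => _ //; exact: mbox.
Qed.

End row_vectors.

(** * Lipschitz functions on the line *)

Section lipschitz_derivable.
Context {R : realType}.
Local Notation mu := (@lebesgue_measure R).

(** Both measures are infima over the same covers by half-open intervals, and the Stieltjes length
    of each interval is at most [K] times its ordinary length. *)
Lemma stieltjes_null_dominates (g : cumulative R R) (K : R) :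
  0 < K -> (forall x y, x <= y -> g y - g x <= K * (y - x)) ->
  lebesgue_stieltjes_measure g `<< mu.
Proof.
move=> K0 gK; apply/null_content_dominatesP => A mA A0.
apply/eqP; rewrite eq_le measure_ge0 andbT.
rewrite -(mule0 K%:E) -A0 -lee_pdivrMl//.
rewrite /= /lebesgue_measure /lebesgue_stieltjes_measure/= /measure_extension/=.
apply: le_ereal_inf_tmp => _ [F FA <-].
rewrite lee_pdivrMl// -nneseriesZl//.
apply: (@le_trans _ _ (\sum_(0 <= k <oo) wlength g (F k))%E).
  by apply: ereal_inf_lbound; exists F.
apply: lee_nneseries => [i _ _|i _]; first exact: wlength_ge0.
have [mF _] := FA.
have /ocitvP[->|[[a b] /= ab ->]] := mF i; first by rewrite !wlength0 mule0.
by rewrite !wlength_itv_bnd ?(ltW ab)// -EFinM lee_fin gK// ltW.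
Qed.

Lemma stieltjes_itvoc (g : cumulative R R) (a b : R) : a <= b ->
  lebesgue_stieltjes_measure g `]a, b]%classic = (g b - g a)%:E.
Proof.
move=> ab; rewrite /lebesgue_stieltjes_measure/= /measure_extension/=.
by rewrite measurable_mu_extE/= ?wlength_itv_bnd//; exact: is_ocitv.
Qed.

(** Adding L x makes f nondecreasing. The Stieltjes measure of the sum is absolutely continuous, so
    the sum is a primitive of its Radon-Nikodym density and is derivable almost everywhere by
    Lebesgue differentiation. *)
Lemma lipschitz_ae_derivable (f : R -> R) (L : R) :
  (forall x y, `|f x - f y| <= L * `|x - y|) ->
  {ae mu, forall x, derivable f x 1}.
Proof.
move=> fL.
have L0 : 0 <= L.
  by have := fL 1 0; rewrite subr0 normr1 mulr1; apply: le_trans.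
pose g x := f x + L * x.
have fc : continuous f.
  move=> x; apply/cvgrPdist_le => e e0; near=> y.
  apply: (le_trans (fL _ _)).
  rewrite (@le_trans _ _ ((L + 1) * `|x - y|)) ?ler_wpM2r ?lerDl//.
  rewrite -ler_pdivlMl ?ltr_wpDl//.
  near: y; apply: cvgr_dist_le; first exact: cvg_id.
  by rewrite mulr_gt0 ?invr_gt0 ?ltr_wpDl.
have gc : continuous g.
  by move=> x; apply: continuousD; [exact: fc | exact: mulrl_continuous].
have gnd : nondecreasing g.
  move=> x y xy; rewrite /g -subr_ge0.
  have := fL y x; rewrite ler_norml ger0_norm ?subr_ge0// => /andP[+ _].
  by lra.
have grc : right_continuous g by exact: right_continuousW.
pose cg := isCumulative.Build R _ R g gnd grc.
pose gC : cumulative R R := HB.pack g cg.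
have gK x y : x <= y -> gC y - gC x <= (2 * L + 1) * (y - x).
  move=> xy; rewrite /= /g.
  have := fL y x; rewrite ler_norml ger0_norm ?subr_ge0// => /andP[_ h].
  by lra.
have dom := stieltjes_null_dominates gC (2 * L + 1) ltac:(lra) gK.
(* Restricted to ]-k, k] the Stieltjes measure is finite, which makes its density integrable. *)
suff : forall k : nat, {ae mu, forall x, x \in `](- k%:R), k%:R[%R -> derivable f x 1}.
  move=> /ae_foralln; apply: filterS => x xk.
  apply: (xk (Num.bound x));
    by rewrite in_itv/= ltrNl unstable.ltrNbound unstable.ltr_bound.
move=> k; pose E : set (measurableTypeR R) := `](- k%:R), k%:R]%classic.
have mE : measurable E by exact: measurable_itv.
pose nu := lebesgue_stieltjes_measure gC.
have nuE (a b : R) : a <= b ->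
  nu `]a, b]%classic = (g b - g a)%:E by exact: stieltjes_itvoc.
have nuEoo : (nu E < +oo)%E.
  by rewrite /E nuE ?ltry// ge0_cp// ler0n.
pose nuk : {finite_measure set _ -> \bar R} := mfrestr mE nuEoo.
have domk : nuk `<< mu.
  apply/null_content_dominatesP => A mA A0.
  have mAE : measurable (A `&` E) by exact: measurableI.
  rewrite /nuk/= /mfrestr /mrestr.
  apply/eqP; rewrite eq_le measure_ge0 andbT.
  have /null_content_dominatesP/(_ A mA A0) <- := dom.
  by apply: le_measure; rewrite ?inE// => x [].
have [phi [phi0 phifin iphi phiE]] := radon_nikodym_sigma_finite domk.
pose p (x : R) : R := fine (phi x).
have pE : EFin \o p = phi by apply/funext => x; rewrite /= fineK.
have ip : mu.-integrable setT (EFin \o p) by rewrite pE.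
have lp : locally_integrable setT p.
  by have := integrable_locally (@measurableT _ R) ip; rewrite patch_setT.
have ipy (y : R) : mu.-integrable [set` Interval (BRight (- k%:R)) (BRight y)] (EFin \o p).
  exact: integrableS ip.
have := @FTC1 R p (BRight (- k%:R)) ipy lp.
apply: filterS; first exact: (ae_filter_ringOfSetsType mu).
move=> x /= Fx; rewrite in_itv/= => /andP[kx xk].
have [dF _] := Fx kx.
(* Near x the primitive of the density based at -k differs from g by the constant g(-k). *)
have gF : \forall y \near x, (\int[mu]_(t in `](- k%:R), y]) p t)%R + g (- k%:R) = g y.
  near=> y.
  have ky : - k%:R < y by near: y; exact: lt_nbhsr.
  have yk : y < k%:R by near: y; exact: lt_nbhsl.
  rewrite /Rintegral; under eq_integral do rewrite /p fineK//.
  rewrite -phiE; last exact: measurable_itv.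
  rewrite /nuk/= /mfrestr /mrestr (_ : _ `&` E = `](- k%:R), y]%classic).
    by rewrite -/nu [nu _](nuE _ _ (ltW ky))/= subrK.
  apply/seteqP; split=> [t [] //|t]; rewrite /E /= !in_itv/= => /andP[t1 t2].
  by rewrite t1 t2 (le_trans t2 (ltW yk)).
have dg : derivable g x 1.
  exact: near_eq_derivable gF (derivableD dF (derivable_cst _ _ _)).
have -> : f = g - (cst L * id) by apply/funext => y; rewrite /g !fctE addrK.
apply: derivableB; first exact: dg.
by apply: derivableM; [exact: derivable_cst|exact: derivable_id].
Unshelve. all: by end_near. Qed.

End lipschitz_derivable.

(** * Density points are not porous *)

Section porosity.
Context {R : realType}.
Local Notation mu := (@lebesgue_measure R).

(** This holds at every density point t of A: a ball of radius eta |s| around t + s that misses A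
    would occupy the fraction eta / (1 + eta) of the ball of radius (1 + eta) |s| around t, at
    arbitrarily small scales. *)
Lemma ae_nonporous (A : set R) : measurable A ->
  {ae mu, forall t, A t -> forall eta, 0 < eta ->
    exists2 del, 0 < del & forall s, `|s| < del ->
      exists2 s', `|s' - s| <= eta * `|s| & A (t + s')}.
Proof.
move=> mA; have := lebesgue_density mA.
apply: filterS; first exact: (ae_filter_ringOfSetsType mu).
move=> t + At eta eta0; rewrite indicE mem_set//= => dens.
have e1 : 0 < 1 + eta by lra.
have lt1 : ((1 + eta)^-1%:E < 1%:E :> \bar R)%E.
  by rewrite lte_fin invf_lt1//; lra.
(* The threshold 1 / (1 + eta) is exactly the fraction left over when the small ball is removed. *)
have : \forall r \near 0^'+, ((1 + eta)^-1%:E < mu (A `&` ball t r) * (mu (ball t r))^-1)%E.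
  have := dens [set x | ((1 + eta)^-1%:E < x)%E]; apply.
  exact: lt_nbhsr.
move=> [d /= d0 dP]; exists (d / (1 + eta)); first by rewrite divr_gt0.
move=> s sd; have [->|s0] := eqVneq s 0.
  by exists 0; rewrite ?subrr ?normr0 ?mulr0// addr0.
have s1 : 0 < `|s| by rewrite normr_gt0.
apply: contrapT => /forall2NP nA.
pose r := (1 + eta) * `|s|.
have r0 : 0 < r by rewrite mulr_gt0.
have rd : ball 0 d r.
  by rewrite -ball_normE/= sub0r normrN gtr0_norm// /r mulrC -ltr_pdivlMr.
have := dP r rd r0; rewrite lebesgue_measure_ball ?(ltW r0)// inver.
rewrite mulrn_eq0/= gt_eqF// lte_pdivlMr ?mulrn_wgt0// -EFinM.
apply/negP; rewrite -leNgt.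
have mB x e : measurable (ball x e : set R) by apply: measurable_realfun.measurable_ball.
have es0 : 0 < eta * `|s| by rewrite mulr_gt0.
have dis : (A `&` ball t r) `&` ball (t + s) (eta * `|s|) = set0.
  rewrite -subset0 => y [[Ay _]]; rewrite -ball_normE/= => ysd.
  have [] := nA (y - t); last by rewrite addrCA subrr addr0.
  apply; rewrite ltW//; move: ysd; rewrite distrC; congr (`|_| < _); lra.
have : (mu (A `&` ball t r) + mu (ball (t + s)%R (eta * `|s|)%R) <= mu (ball t r))%E.
  have mAB : measurable (A `&` ball t r) by apply: measurableI.
  rewrite -(measureU mu mAB (mB _ _) dis).
  apply: le_measure; rewrite ?inE; [exact: (measurableU _ _ mAB (mB _ _))|exact: mB|].
  move=> y [[_ //]|]; rewrite -!ball_normE/= => ysd.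
  have := ler_distD (t + s) t y.
  rewrite opprD addNKr normrN /r.
  by lra.
rewrite !lebesgue_measure_ball ?(ltW r0) ?(ltW es0)//.
rewrite -leeBrDr// => /le_trans; apply.
rewrite -EFinB lee_fin /r ler_pdivlMl//.
rewrite -mulrnBl [X in (X - _) *+ 2]mulrDl mul1r addrK.
by rewrite mulrnAr.
Qed.

End porosity.

(** * Rademacher's theorem *)

Section null_sections.
Context {R : realType} {n : nat}.
Local Notation mu := (@lebesgue_measure R).

Lemma null_of_null_sections_tail (N : set 'rV[R]_n.+1) : measurable N ->
  (forall t, lebesgue_rV R n [set y | N (cons_rV (t, y))] = 0) ->
  lebesgue_rV R n.+1 N = 0.
Proof.
move=> mN N0; rewrite /= /lebesgue_cons /pushforward /product_measure1.
apply: integral0_eq => t _ /=.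
by rewrite -[RHS](N0 t); congr (lebesgue_rV R n _); apply/funext => y; rewrite xsectionE.
Qed.

(** The measure is defined by integrating the measures of the tail sections; the other order of
    integration comes from uniqueness of the product measure. *)
Lemma null_of_null_sections_head (N : set 'rV[R]_n.+1) : measurable N ->
  (forall y, mu [set t | N (cons_rV (t, y))] = 0) ->
  lebesgue_rV R n.+1 N = 0.
Proof.
move=> mN N0; rewrite /= /lebesgue_cons /pushforward.
have mc : measurable (@cons_rV R n @^-1` N : set (measurableTypeR R * 'rV[R]_n)).
  by rewrite -[X in measurable X]setTI; exact: measurable_cons_rV.
rewrite (@product_measure_unique _ _ _ _ _ _ _ (mu \x^ lebesgue_rV R n)%E)//; last first.
  by move=> A B mA mB; exact: product_measure2E.
rewrite /product_measure2.
apply: integral0_eq => y _ /=.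
by rewrite -[RHS](N0 y); congr (mu _); apply/funext => t; rewrite ysectionE.
Qed.

End null_sections.

Definition dot {R : realType} {n : nat} (q z : 'rV[R]_n) : R :=
  \sum_i q ord0 i * z ord0 i.

Lemma negligible_bigcup_count d (T : sigmaRingType d) (R : realFieldType)
    (mu : {measure set T -> \bar R}) (I : countType) (F : I -> set T) :
  (forall i, mu.-negligible (F i)) -> mu.-negligible (\bigcup_i F i).
Proof.
move=> nF.
have -> : \bigcup_i F i = \bigcup_k oapp F set0 (unpickle k).
  apply/seteqP; split=> [x [i _ Fx]|x [k _]].
    by exists (pickle i); rewrite //= pickleK.
  by case: unpickle => //= i Fx; exists i.
by apply: negligible_bigcup => k; case: unpickle => //=; exact: negligible_set0.
Qed.

Section dot_theory.
Context {R : realType} {n : nat}.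
Implicit Types q z w : 'rV[R]_n.

Lemma dotDr q z w : dot q (z + w) = dot q z + dot q w.
Proof. by rewrite /dot -big_split/=; apply: eq_bigr => i _; rewrite mxE mulrDr. Qed.

Lemma dotDl q q' z : dot (q + q') z = dot q z + dot q' z.
Proof. by rewrite /dot -big_split/=; apply: eq_bigr => i _; rewrite mxE mulrDl. Qed.

Lemma dotBl q q' z : dot (q - q') z = dot q z - dot q' z.
Proof. by rewrite /dot -sumrB; apply: eq_bigr => i _; rewrite !mxE mulrBl. Qed.

Lemma dot_delta q i (s : R) : dot q (s *: delta_mx ord0 i) = q ord0 i * s.
Proof.
rewrite /dot (bigD1 i)//= big1 => [|j ji]; rewrite !mxE !eqxx/= ?eqxx ?mulr1 ?addr0//.
by rewrite (negbTE ji) !mulr0.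
Qed.

Lemma ler_norm_dot q z : `|dot q z| <= n%:R * `|q| * `|z|.
Proof.
apply: (le_trans (ler_norm_sum _ _ _)).
rewrite -mulrA mulr_natl -[X in _ *+ X]card_ord -sumr_const.
by apply: ler_sum => i _; rewrite normrM ler_pM// normrV_coord.
Qed.

End dot_theory.

Section almost_linear.
Context {R : realType}.

(* The difference quotients are only probed along the directions in the range
   of i, so that a block of coordinates can be treated separately. *)
Definition almost_linear {n p} (i : 'rV[R]_p -> 'rV[R]_n) (f : 'rV[R]_n -> R)
    (q : 'rV[R]_p) (d e : R) : set 'rV[R]_n :=
  [set x | forall z, `|z| <= d -> `|f (x + i z) - f x - dot q z| <= e * `|z|].

(** Rational slopes and radii 1 / (k + 1) make this a countable combination of sets that are closed
    for continuous f, hence measurable. The slope may depend on the accuracy 1 / (m + 1);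
    [approx_diff_has_grad] shows that the slopes converge. *)
Definition approx_diff {n p} (i : 'rV[R]_p -> 'rV[R]_n) (f : 'rV[R]_n -> R) :
    set 'rV[R]_n :=
  \bigcap_(m : nat) \bigcup_(qk : 'rV[rat]_p * nat)
     almost_linear i f (map_mx ratr qk.1) qk.2.+1%:R^-1 m.+1%:R^-1.

Lemma closed_almost_linear {n p} (i : 'rV[R]_p -> 'rV[R]_n) f q d e :
  continuous f -> closed (almost_linear i f q d e).
Proof.
move=> cf.
rewrite (_ : almost_linear _ _ _ _ _ = \bigcap_(z in [set z | `|z| <= d])
    ((fun x => `|f (x + i z) - f x - dot q z|) @^-1` [set t | t <= e * `|z|])).
  apply: closed_bigI => z _.
  apply: preimage_closed; last exact: closed_le.
  move=> x _.
  have h1 : (fun x => x + i z) @ x --> x + i z.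
    exact: (cvgD (@cvg_id _ (nbhs x)) (cvg_cst (i z))).
  have h2 : (fun x => f (x + i z)) @ x --> f (x + i z) := cvg_comp _ f h1 (cf _).
  exact: cvg_norm (cvgB (cvgB h2 (cf x)) (cvg_cst (dot q z))).
by apply/seteqP; split=> x /= xz; [move=> z; exact: xz|move=> z; exact: (xz z)].
Qed.

Lemma measurable_almost_linear {n p} (i : 'rV[R]_p -> 'rV[R]_n) f q d e :
  continuous f -> measurable (almost_linear i f q d e).
Proof.
move=> cf; rewrite -[X in measurable X]setCK; apply: measurableC.
apply: open_measurable_rV; apply: closed_openC; exact: closed_almost_linear.
Qed.

Lemma measurable_approx_diff {n p} (i : 'rV[R]_p -> 'rV[R]_n) f :
  continuous f -> measurable (approx_diff i f).
Proof.
move=> cf; apply: bigcapT_measurable => m.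
apply: countable_bigcupT_measurable => [|qk]; first exact: countableP.
exact: measurable_almost_linear.
Qed.

Lemma ex_rat_near (a e : R) : 0 < e -> exists q : rat, `|a - ratr q| < e.
Proof.
move=> e0; have [] := @rat_in_itvoo R (a - e) (a + e); first by lra.
move=> q; rewrite in_itv/= => /andP[q1 q2]; exists q.
by rewrite distrC ltr_distl q1 q2.
Qed.

Lemma ex_natV_lt (e : R) : 0 < e -> exists k : nat, k.+1%:R^-1 < e.
Proof.
move=> e0; exists (Num.bound e^-1).
rewrite -[ltRHS]invrK ltf_pV2 ?posrE ?invr_gt0//.
by rewrite (lt_le_trans (unstable.ltr_bound _))// ler_nat.
Qed.

Lemma derivable_almost_linear (g : R -> R) t : derivable g t 1 ->
  forall m : nat, exists (q : rat) (k : nat), forall s, `|s| <= k.+1%:R^-1 ->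
    `|g (t + s) - g t - ratr q * s| <= m.+1%:R^-1 * `|s|.
Proof.
move=> /cvg_ex[a /= ga] m.
have e0 : 0 < m.+1%:R^-1 / 2 :> R by rewrite divr_gt0 ?invr_gt0.
have [q qa] := ex_rat_near a _ e0.
have /cvgrPdist_lt/(_ _ e0)[d /= d0 dP] := ga.
have [k kd] := ex_natV_lt _ d0.
exists q, k => s sk; have [->|s0] := eqVneq s 0.
  by rewrite addr0 subrr mulr0 subr0 !normr0 mulr0.
have := dP s _ s0; rewrite /= sub0r normrN (le_lt_trans sk kd) => /(_ isT).
rewrite [s *: 1]mulr1 [_ *: _]mulrC (addrC s) => h.
set D := g (t + s) - g t in h *.
have -> : D - ratr q * s = ((a - ratr q) - (a - D / s)) * s.
  by rewrite (_ : _ - (a - D / s) = D / s - ratr q) ?mulrBl ?divfK//; lra.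
rewrite normrM ler_wpM2r// (le_trans (ler_normB _ _))//.
by move: qa h; set u := (_^-1); lra.
Qed.

End almost_linear.

Section cons_rV_theory.
Context {R : realType} {n : nat}.
Implicit Types (s t : R) (w y : 'rV[R]_n).

Lemma cons_rVD s t w y :
  cons_rV (s, w) + cons_rV (t, y) = cons_rV (s + t, w + y).
Proof.
apply/rowP => i; rewrite mxE; have [j ->|->] := unliftP ord0 i.
  by rewrite !cons_rVS/= mxE.
by rewrite !cons_rV0.
Qed.

Lemma cons_rVB s t w y :
  cons_rV (s, w) - cons_rV (t, y) = cons_rV (s - t, w - y).
Proof. by apply/eqP; rewrite subr_eq cons_rVD !subrK. Qed.

Lemma cons_rVK (x : 'rV[R]_n.+1) :
  cons_rV (x ord0 ord0, \row_i x ord0 (lift ord0 i)) = x.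
Proof.
apply/rowP => i; have [j ->|->] := unliftP ord0 i.
  by rewrite !cons_rVS/= mxE.
by rewrite !cons_rV0.
Qed.

Lemma norm_cons_rV_leP s w (r : R) : 0 <= r ->
  `|cons_rV (s, w)| <= r <-> `|s| <= r /\ `|w| <= r.
Proof.
move=> r0; rewrite (normrV_leP _ _ r0); split=> [h|[sr wr] i].
  split; first by have := h ord0; rewrite cons_rV0.
  by apply/normrV_leP => // i; have := h (lift ord0 i); rewrite cons_rVS.
have [j ->|->] := unliftP ord0 i; rewrite ?cons_rV0 ?cons_rVS//=.
by move: j; apply/normrV_leP.
Qed.

Lemma dot_cons_rV s t w y :
  dot (cons_rV (s, w)) (cons_rV (t, y)) = s * t + dot w y.
Proof.
by rewrite /dot big_ord_recl !cons_rV0; congr (_ + _); apply: eq_bigr => i _;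
  rewrite !cons_rVS.
Qed.

End cons_rV_theory.

Section rademacher.
Context {R : realType}.

Definition head_dir {n} (s : 'rV[R]_1) : 'rV[R]_n.+1 := cons_rV (s ord0 ord0, 0).
Definition tail_dir {n} (w : 'rV[R]_n) : 'rV[R]_n.+1 := cons_rV (0, w).

(* For closed A this set is closed, unlike the set of density points of A. *)
Definition head_thick {n} (A : set 'rV[R]_n.+1) (eta d : R) : set 'rV[R]_n.+1 :=
  [set x | forall s, `|s| <= d ->
     exists2 s', `|s' - s| <= eta * `|s| & A (x + cons_rV (s', 0))].

Lemma continuous_cons_rV_head {n} : continuous (fun s : R => cons_rV (s, 0 : 'rV[R]_n)).
Proof.
apply: (@lipschitz_continuous _ _ _ _ 1) => s t; rewrite mul1r.
rewrite (_ : _ - _ = cons_rV (s - t, 0)).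
  by apply/norm_cons_rV_leP => //; rewrite normr0.
by apply/eqP; rewrite subr_eq cons_rVD subrK addr0.
Qed.

(** For fixed s the candidates s' fill a compact segment. If none of them works at x, each fails on
    a neighborhood of (s', x) because A is closed, and compactness gives one neighborhood of x where
    all fail. *)
Lemma closed_head_thick {n} (A : set 'rV[R]_n.+1) (eta d : R) :
  closed A -> closed (head_thick A eta d).
Proof.
move=> cA; rewrite (_ : head_thick _ _ _ = \bigcap_(s in [set s : R | `|s| <= d])
  [set x | exists2 s', `|s' - s| <= eta * `|s| & A (x + cons_rV (s', 0))]); last first.
  by apply/seteqP; split=> x /= xA s; exact: xA.
apply: closed_bigI => s _; rewrite -[X in closed X]setCK.
apply: open_closedC; rewrite openE => x /= xA.
have : compact `[s - eta * `|s|, s + eta * `|s|]%classic by exact: segment_compact.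
move=> /compact_near_coveringP/(_ _ (nbhs x) (fun x' s' => ~ A (x' + cons_rV (s', 0)))).
move=> /(_ _) near_cov.
have near_cov' s' : (`[s - eta * `|s|, s + eta * `|s|]%classic) s' ->
    \near s' & x, ~ A (x + cons_rV (s', 0)).
  rewrite /= in_itv/= => s's.
  have nA : ~ A (x + cons_rV (s', 0)).
    move=> As'; apply: xA; exists s' => //.
    by rewrite ler_distl.
  have oA : open (~` A) by exact: closed_openC.
  have cv : (fun p : R * 'rV[R]_n.+1 => p.2 + cons_rV (p.1, 0)) @ (s', x) -->
      x + cons_rV (s', 0).
    have c1 : snd @ nbhs (s', x) --> x by exact: cvg_snd.
    have c2 : fst @ nbhs (s', x) --> s' by exact: cvg_fst.
    exact: (cvgD c1 (cvg_comp fst _ c2 (continuous_cons_rV_head s'))).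
  exact: (cv _ (open_nbhs_nbhs (conj oA nA))).
change (nbhs x (~` [set x | exists2 s', `|s' - s| <= eta * `|s| & A (x + cons_rV (s',
  0))])).
apply: filterS (near_cov near_cov') => y yA -[s' s's]; apply: (yA s').
by rewrite /= in_itv/= -ler_distl.
Qed.

Lemma measurable_head_section {n} (N : set 'rV[R]_n.+1) (y : 'rV[R]_n) :
  measurable N -> measurable [set t : measurableTypeR R | N (cons_rV (t, y))].
Proof.
move=> mN; have := @measurable_ysection _ _ _ _ (@cons_rV R n @^-1` N) y.
rewrite ysectionE; apply.
by rewrite -[X in measurable X]setTI; exact: measurable_cons_rV.
Qed.

Lemma measurable_tail_section {n} (N : set 'rV[R]_n.+1) (t : R) :
  measurable N -> measurable [set y : 'rV[R]_n | N (cons_rV (t, y))].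
Proof.
move=> mN; have := @measurable_xsection _ _ _ _ (@cons_rV R n @^-1` N) t.
rewrite xsectionE; apply.
by rewrite -[X in measurable X]setTI; exact: measurable_cons_rV.
Qed.

(* Induction on the dimension. At almost every point f is differentiable in the
   first coordinate, in the remaining ones, and the closed set A of points where
   the latter derivative is almost q is not porous in the first direction. An
   increment (s, w) is then compared with the path through x + (s', 0), where
   x + (s', 0) lies in A and |s' - s| is small with respect to |s|. *)
Lemma rademacher_approx n (f : 'rV[R]_n -> R) (L : R) :
  (forall x y, `|f x - f y| <= L * `|x - y|) ->
  (lebesgue_rV R n).-negligible (~` approx_diff id f).
Proof.
elim: n f => [|n IH] f fL.
  rewrite (_ : ~` _ = set0); first exact: negligible_set0.
  rewrite -subset0 => x; apply => m _; exists (0, 0%N) => // z _ /=.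
  have -> : x + z = x by apply/rowP => -[].
  by rewrite subrr sub0r normrN /dot big_ord0 normr0 mulr_ge0 ?invr_ge0.
have cf : continuous f by exact: lipschitz_continuous fL.
have L0 : 0 <= L.
  have := fL (cons_rV (1, 0)) 0; rewrite subr0.
  have : 0 < `|cons_rV (1, 0 : 'rV[R]_n)|.
    rewrite lt_neqAle eq_sym normr_ge0 normr_eq0 andbT.
    by apply/eqP => /rowP/(_ ord0)/eqP; rewrite cons_rV0 mxE oner_eq0.
  by move=> c0 /(le_trans (normr_ge0 _)); rewrite pmulr_lge0.
pose A (qk : 'rV[rat]_n * nat) m :=
  almost_linear tail_dir f (map_mx ratr qk.1) qk.2.+1%:R^-1 m.+1%:R^-1.
(* The points of [A qk m] near which this set leaves relative gaps of size 1 / (j + 1) along the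
   first axis at arbitrarily small scales; on each line parallel to that axis they are negligible by
   [ae_nonporous]. *)
pose P qk m j := A qk m `&` ~` \bigcup_l head_thick (A qk m) j.+1%:R^-1 l.+1%:R^-1.
pose N1 := ~` approx_diff head_dir f.
pose N2 := ~` approx_diff tail_dir f.
pose N3 := \bigcup_(i : 'rV[rat]_n * nat * nat * nat) P i.1.1 i.1.2 i.2.
have N1_0 : (lebesgue_rV R n.+1).-negligible N1.
  exists N1; split => //; first by apply: measurableC; exact: measurable_approx_diff.
  apply: null_of_null_sections_head => [|y].
    by apply: measurableC; exact: measurable_approx_diff.
  have gL t t' : `|f (cons_rV (t, y)) - f (cons_rV (t', y))| <= L * `|t - t'|.
    apply: (le_trans (fL _ _)); rewrite ler_wpM2l//.
    rewrite (_ : _ - _ = cons_rV (t - t', 0)); last first.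
      by apply/eqP; rewrite subr_eq cons_rVD subrK add0r.
    by apply/norm_cons_rV_leP => //; rewrite normr0.
  apply: measure_negligible.
    by apply: measurable_head_section; apply: measurableC; exact: measurable_approx_diff.
  apply: negligibleS (lipschitz_ae_derivable _ _ gL).
  move=> t /= Nt dt; apply: Nt => m _.
  have [q [k qk]] := derivable_almost_linear _ _ dt m.
  exists (\row_(_ < 1) q, k) => // z /= zk.
  rewrite /head_dir cons_rVD addr0 /dot big_ord1 !mxE.
  apply: le_trans (qk _ (le_trans (normrV_coord _ _) zk)) _.
  by rewrite ler_wpM2l ?invr_ge0// normrV_coord.
have N2_0 : (lebesgue_rV R n.+1).-negligible N2.
  exists N2; split => //; first by apply: measurableC; exact: measurable_approx_diff.
  apply: null_of_null_sections_tail => [|t].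
    by apply: measurableC; exact: measurable_approx_diff.
  have gL y y' : `|f (cons_rV (t, y)) - f (cons_rV (t, y'))| <= L * `|y - y'|.
    apply: (le_trans (fL _ _)); rewrite ler_wpM2l//.
    rewrite (_ : _ - _ = cons_rV (0, y - y')); last first.
      by apply/eqP; rewrite subr_eq cons_rVD subrK add0r.
    by apply/norm_cons_rV_leP => //; rewrite normr0.
  apply: measure_negligible.
    by apply: measurable_tail_section; apply: measurableC; exact: measurable_approx_diff.
  apply: negligibleS (IH _ gL).
  move=> y /= Ny dy; apply: Ny => m _.
  have [qk _ qkP] := dy m I.
  by exists qk => // w wk; rewrite /tail_dir cons_rVD addr0; exact: qkP.
have N3_0 : (lebesgue_rV R n.+1).-negligible N3.
  apply: negligible_bigcup_count => -[[qk m] j] /=.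
  have cA : closed (A qk m) by exact: closed_almost_linear.
  have mP : measurable (P qk m j).
    apply: measurableI; first exact: measurable_almost_linear.
    apply: measurableC; apply: bigcupT_measurable => l.
    rewrite -[X in measurable X]setCK; apply: measurableC.
    by apply: open_measurable_rV; apply: closed_openC; exact: closed_head_thick.
  exists (P qk m j); split => //.
  apply: null_of_null_sections_head => // y.
  apply: measure_negligible; first exact: measurable_head_section.
  have mAy : measurable [set t : R | A qk m (cons_rV (t, y))].
    by apply: measurable_head_section; exact: measurable_almost_linear.
  apply: negligibleS (ae_nonporous _ mAy).
  move=> t /= [At nt] At'; apply: nt.
  have [d d0 dP] := At' At j.+1%:R^-1 ltac:(by rewrite invr_gt0).
  have [l ld] := ex_natV_lt _ d0.
  exists l => // s sl; have [s' s's As'] := dP s (le_lt_trans sl ld).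
  by exists s' => //; rewrite cons_rVD addr0.
apply: negligibleS (negligibleU (negligibleU N1_0 N2_0) N3_0) => x nx.
apply: contrapT => /not_orP[/not_orP[/contrapT x1 /contrapT x2] x3].
apply: nx => m _.
(* The tolerance 1 / (M + 1) serves both for the slopes and for the gaps. It is incurred four times
   below: twice multiplied by L, for replacing s by s' and back, and once for each of the two
   slopes. Hence 2 L + 2. *)
have [M MP] := ex_natV_lt (m.+1%:R^-1 / (2 * L + 2)) ltac:(by rewrite divr_gt0
  ?invr_gt0//; lra).
have [[a k1] _ /= aP] := x1 M I.
have [[q k] _ /= qP] := x2 M I.
have [l _ lP] : (\bigcup_l head_thick (A (q, k) M) M.+1%:R^-1 l.+1%:R^-1) x.
  by apply: contrapT => nl; apply: x3; exists (q, k, M, M).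
pose K := maxn k (maxn k1 l).
exists (row_mx a q : 'rV_(1 + n), K) => // z zK.
have Kle j : (j <= K)%N -> K.+1%:R^-1 <= j.+1%:R^-1 :> R.
  by move=> jK; rewrite lef_pV2 ?posrE// ler_nat ltnS.
have kK := Kle k ltac:(by rewrite leq_maxl).
have k1K := Kle k1 ltac:(by rewrite /K maxnCA leq_maxl).
have lK := Kle l ltac:(by rewrite /K (maxnC k1) maxnCA leq_maxl).
rewrite -(cons_rVK z) in zK *; move: (z ord0 ord0) (\row_i _) zK => s w zK.
have [sK wK] : `|s| <= K.+1%:R^-1 /\ `|w| <= K.+1%:R^-1.
  by apply/norm_cons_rV_leP => //; rewrite invr_ge0.
have [sz wz] : `|s| <= `|cons_rV (s, w)| /\ `|w| <= `|cons_rV (s, w)|.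
  exact/norm_cons_rV_leP.
have [s' s's /(_ w (le_trans wK kK)) As'] := lP s (le_trans sK lK).
have := aP (const_mx s); rewrite /head_dir /dot big_ord1 !mxE.
have s_const : `|const_mx s : 'rV[R]_1| <= `|s|.
  by apply/normrV_leP => // i; rewrite mxE.
move=> /(_ (le_trans s_const (le_trans sK k1K))) aPs.
have -> : map_mx ratr (row_mx a q : 'rV_(1 + n)) = cons_rV (ratr (a ord0 ord0) :
  R, map_mx ratr q).
  by rewrite (@map_row_mx _ _ ratr 1 1 n) /cons_rV/= -map_scalar_mx/= -mx11_scalar.
rewrite -/(dot _ _) dot_cons_rV.
set e := M.+1%:R^-1 in MP aP qP lP s's As' aPs *.
set N := `|cons_rV (s, w)| in sz wz *.
set q' := map_mx ratr q in As' *; set a' := ratr _ in aPs *.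
have e0 : 0 < e by rewrite invr_gt0.
have fs (t t' : R) (v : 'rV[R]_n) :
  `|f (x + cons_rV (t, v)) - f (x + cons_rV (t', v))| <= L * `|t - t'|.
  apply: (le_trans (fL _ _)); rewrite ler_wpM2l//.
  rewrite opprD addrACA subrr add0r.
  have -> : cons_rV (t, v) - cons_rV (t', v) = cons_rV (t - t', 0 : 'rV[R]_n).
    by rewrite -(subrr v); exact: cons_rVB.
  by apply/norm_cons_rV_leP => //; rewrite normr0.
have b1 := fs s s' w; have b3 := fs s' s 0.
move: As'; rewrite /tail_dir -(addrA x) cons_rVD addr0 add0r => b2.
rewrite (distrC s) in b1.
have b13 : L * `|s' - s| <= L * (e * N).
  by rewrite ler_wpM2l// (le_trans s's)// ler_wpM2l// ltW.
have b2' : e * `|w| <= e * N by rewrite ler_wpM2l// ltW.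
have b4' : e * `|const_mx s : 'rV[R]_1| <= e * N.
  by rewrite ler_wpM2l ?(ltW e0)// (le_trans s_const).
have eN : e * N * (2 * L + 2) <= m.+1%:R^-1 * N.
  have MP' : e * (2 * L + 2) <= m.+1%:R^-1 by rewrite -ler_pdivlMr ?(ltW MP)//; lra.
  rewrite (_ : e * N * (2 * L + 2) = e * (2 * L + 2) * N); last by lra.
  by rewrite ler_wpM2r ?normr_ge0.
apply: le_trans eN.
set T1 := _ - _ in b1; set T2 := _ - _ in b2; set T3 := _ - _ in b3; set T4 := _ - _ in aPs.
(* The path goes from x to x + (s, 0), then to x + (s', 0), x + (s', w) and x + (s, w). [T4] and
   [T2] are the slope errors of the head and tail steps, [T3] and [T1] the changes of f when s and
   s' are exchanged. *)
have -> : f (x + cons_rV (s, w)) - f x - (a' * s + dot q' w) = (T1 + T2) + (T3 + T4).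
  by rewrite /T1 /T2 /T3 /T4; lra.
have n1 := ler_normD (T1 + T2) (T3 + T4).
have n2 := ler_normD T1 T2; have n3 := ler_normD T3 T4.
have : e * N * (2 * L + 2) = L * (e * N) * 2 + e * N * 2 by lra.
by lra.
Qed.

End rademacher.

Lemma is_diff_near {R : realType} (V W : normedModType R) (f : V -> W)
    (df : {linear V -> W}) x : continuous df ->
  (forall e, 0 < e -> \forall z \near 0, `|f (z + x) - f x - df z| <= e * `|z|) ->
  is_diff x f df.
Proof.
move=> cdf fx.
have eqf : f \o shift x = cst (f x) + df +o_ 0 id.
  apply/eqaddoP => e e0; apply: filterS (fx e e0) => z.
  by rewrite !fctE/= opprD addrA.
have hdf := diff_unique cdf eqf.
by apply: DiffDef => //; apply/diff_locallyP; rewrite hdf; split.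
Qed.

Section gradient.
Context {R : realType} {n : nat}.
Implicit Types (f : 'rV[R]_n -> R) (x q : 'rV[R]_n).

Definition has_grad f x q := forall e, 0 < e -> exists2 d, 0 < d &
  almost_linear id f q d e x.

Lemma dot_is_linear q : linear (dot q : 'rV[R]_n -> R).
Proof.
move=> a z w; rewrite dotDr; congr (_ + _).
rewrite /dot [RHS]big_distrr/=; apply: eq_bigr => i _.
by rewrite mxE mulrCA.
Qed.

HB.instance Definition _ q := GRing.isLinear.Build R 'rV[R]_n R *%R (dot q)
  (dot_is_linear q).

Lemma continuous_dot q : continuous (dot q).
Proof.
apply: (@lipschitz_continuous _ _ _ _ (n%:R * `|q|)) => z w.
by rewrite -linearB ler_norm_dot.
Qed.

Lemma has_grad_is_diff f x q : has_grad f x q -> is_diff x f (dot q).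
Proof.
move=> fq; apply: is_diff_near; first exact: continuous_dot.
move=> e e0; have [d d0 dP] := fq e e0.
near=> z; have := dP z; rewrite (addrC z); apply.
by near: z; apply: (@nbhs0_le R 'rV[R]_n).
Unshelve. all: by end_near. Qed.

Lemma has_grad_derive f x q i : has_grad f x q ->
  'D_(delta_mx ord0 i) f x = q ord0 i.
Proof.
move=> /has_grad_is_diff fq; rewrite deriveE; last exact: ex_diff.
by rewrite diff_val -[delta_mx _ _]scale1r dot_delta mulr1.
Qed.

(** Tested on a common small multiple of a basis vector, the slopes of accuracies m and p differ by
    at most the sum of their tolerances. So the intervals of radius [e m] around [q m i] meet
    pairwise, and the supremum of their left endpoints lies in all of them: it is the i-th partial
    derivative. *)
Lemma approx_diff_has_grad f x : approx_diff id f x -> exists q, has_grad f x q.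
Proof.
move=> fx.
pose A m (qk : 'rV[rat]_n * nat) :=
  almost_linear id f (map_mx ratr qk.1) qk.2.+1%:R^-1 (m.+1%:R^-1 : R) x.
have /choice[qk qkP] : forall m, exists qk, A m qk.
  by move=> m; have [qk _ ?] := fx m I; exists qk.
pose q m i : R := ratr ((qk m).1 ord0 i); pose e m : R := m.+1%:R^-1.
have qe m p i : q m i - e m <= q p i + e p.
  pose d : R := Num.min (qk m).2.+1%:R^-1 (qk p).2.+1%:R^-1.
  have d0 : 0 < d by rewrite lt_min !invr_gt0 !ltr0Sn.
  have nd : `|d *: delta_mx ord0 i : 'rV[R]_n| <= d.
    apply/normrV_leP => [|j]; first exact: ltW.
    rewrite !mxE normrM gtr0_norm// ler_piMr ?(ltW d0)//.
    by case: (_ && _); rewrite ?normr1 ?normr0.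
  have dm : d <= (qk m).2.+1%:R^-1 by rewrite ge_min lexx.
  have dp : d <= (qk p).2.+1%:R^-1 by rewrite ge_min lexx orbT.
  have := qkP m (d *: delta_mx ord0 i) (le_trans nd dm).
  have := qkP p (d *: delta_mx ord0 i) (le_trans nd dp).
  rewrite !dot_delta !mxE -/(q m i) -/(q p i) -/(e m) -/(e p).
  set D := f _ - f x => h1 h2.
  have e0 k : 0 <= e k by rewrite invr_ge0.
  have {}h1 := le_trans h1 (ler_wpM2l (e0 p) nd).
  have {}h2 := le_trans h2 (ler_wpM2l (e0 m) nd).
  move: h1 h2; rewrite !ler_norml => /andP[h1 h1'] /andP[h2 h2'].
  rewrite -(ler_pM2r d0); lra.
pose a i := sup [set q m i - e m | m in setT].
have ha m i : `|a i - q m i| <= e m.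
  have hs : has_sup [set q m i - e m | m in setT].
    split; first by exists (q 0%N i - e 0%N), 0%N.
    by exists (q 0%N i + e 0%N) => _ [p _ <-]; exact: qe.
  rewrite ler_distl; apply/andP; split.
    by apply: ub_le_sup; [case: hs|exists m].
  by apply: ge_sup; [case: hs|move=> _ [p _ <-]; exact: qe].
exists (\row_i a i) => eps eps0.
(* One tolerance comes from [almost_linear], and n more from replacing the rational slope by the
   limit, since [ler_norm_dot] has the factor n. *)
have [m me] := ex_natV_lt (eps / (n%:R + 1)) ltac:(by rewrite divr_gt0 ?ltr_wpDl).
exists (qk m).2.+1%:R^-1 => [|z zd]; first by rewrite invr_gt0.
have h := qkP m z zd.
pose qm : 'rV[R]_n := map_mx ratr (qk m).1.
have em0 : 0 < e m by rewrite invr_gt0.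
have hq : `|qm - \row_i a i| <= e m.
  apply/normrV_leP => [|i]; [exact: ltW|rewrite !mxE distrC; exact: ha].
rewrite -/qm in h.
rewrite (_ : _ - dot _ z = (f (x + id z) - f x - dot qm z) + dot (qm - \row_i a i) z);
  last first.
  by rewrite dotBl addrA subrK.
apply: (le_trans (ler_normD _ _)).
have h2 := ler_norm_dot (qm - \row_i a i) z.
have h3 : n%:R * `|qm - \row_i a i| * `|z| <= n%:R * e m * `|z|.
  by rewrite ler_wpM2r// ler_wpM2l.
have h4 : e m * (n%:R + 1) * `|z| <= eps * `|z|.
  rewrite ler_wpM2r// -ler_pdivlMr; first exact: ltW.
  by rewrite ltr_wpDl.
rewrite -/(e m) in h; lra.
Qed.

End gradient.

Lemma rademacher {R : realType} {n : nat} (f : 'rV[R]_n -> R) (L : R) :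
  (forall x y, `|f x - f y| <= L * `|x - y|) ->
  {ae lebesgue_rV R n, forall x, exists q, has_grad f x q}.
Proof.
move=> fL; apply: negligibleS (rademacher_approx _ _ _ fL) => x nx /approx_diff_has_grad.
exact: nx.
Qed.

(** * Steklov averages *)

Section average.
Context {R : realType}.
Implicit Types (phi psi Psi : R -> R) (h : R).

(* The base point -1 makes primitive differentiable on a neighborhood of [0, h],
   in particular at 0. *)
Definition primitive phi (t : R) : R :=
  (\int[@lebesgue_measure R]_(s in `[- 1, t]) phi s)%R.

Lemma is_derive_primitive phi (t : R) : continuous phi -> - 1 < t ->
  is_derive t 1 (primitive phi) (phi t).
Proof.
move=> cphi t1.
have iphi : (@lebesgue_measure R).-integrable `[- 1, t + 1] (EFin \o phi).
  apply: continuous_compact_integrable; first exact: segment_compact.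
  exact: continuous_subspaceT.
have [d1 d2] := @continuous_FTC1_closed R phi (- 1) t (t + 1) ltac:(lra) iphi t1 (cphi t).
by apply: DeriveDef; [exact: d1|rewrite -derive1E d2].
Qed.

Definition average h phi : R := (primitive phi h - primitive phi 0) / h.

(** Pointwise bounds on [0, h] pass to averages through this mean value, with no estimate of an
    integral. *)
Lemma average_mean h phi : 0 < h -> continuous phi ->
  exists2 t, 0 <= t <= h & average h phi = phi t.
Proof.
move=> h0 cphi.
have [c /andP[c0 ch] cE] : exists2 c, c \in `]0, h[%R &
    primitive phi h - primitive phi 0 = phi c * (h - 0).
  apply: MVT => // [t|].
    by rewrite in_itv/= => /andP[t0 _]; apply: is_derive_primitive => //; lra.
  apply: derivable_within_continuous => t; rewrite in_itv/= => /andP[t0 _].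
  have := @is_derive_primitive phi t cphi ltac:(lra).
  by move=> [].
exists c; first by rewrite !bnd_simp in c0 ch; rewrite !ltW.
by rewrite /average cE subr0 mulfK ?gt_eqF.
Qed.

(** An average may be computed from any antiderivative, so linearity and translation of averages
    reduce to rules of differentiation. *)
Lemma average_unique h phi Psi : 0 < h -> continuous phi ->
  (forall t, 0 <= t <= h -> is_derive t 1 Psi (phi t)) ->
  average h phi = (Psi h - Psi 0) / h.
Proof.
move=> h0 cphi dPsi; rewrite /average; congr (_ / h).
pose D := Psi - primitive phi.
have dD t : 0 <= t <= h -> is_derive t 1 D 0.
  move=> th; rewrite -(subrr (phi t)).
  apply: is_deriveB; first exact: dPsi.
  by apply: is_derive_primitive => //; case/andP: th => *; lra.
have [c _] : exists2 c, c \in `]0, h[%R & D h - D 0 = 0 * (h - 0).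
  apply: (@MVT _ D (cst 0)) => // [t|].
    by rewrite in_itv/= => /andP[t0 th]; apply: dD; rewrite !ltW.
  by apply: derivable_within_continuous => t; rewrite in_itv/= => /dD[].
by rewrite mul0r /D !fctE; lra.
Qed.

Lemma averageD h phi psi : 0 < h -> continuous phi -> continuous psi ->
  average h (fun t => phi t + psi t) = average h phi + average h psi.
Proof.
move=> h0 cphi cpsi.
rewrite [LHS](_ : _ = ((primitive phi + primitive psi) h - (primitive phi + primitive
  psi) 0) / h).
  by rewrite /average !fctE; lra.
apply: average_unique => // [t|t /andP[t0 _]].
  by apply: continuousD; [exact: cphi|exact: cpsi].
by apply: is_deriveD; apply: is_derive_primitive => //; lra.
Qed.

Lemma averageZ h (a : R) phi : 0 < h -> continuous phi ->
  average h (fun t => a * phi t) = a * average h phi.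
Proof.
move=> h0 cphi.
rewrite [LHS](_ : _ = ((a *: primitive phi) h - (a *: primitive phi) 0) / h).
  by rewrite /average !fctE /GRing.scale/=; lra.
apply: average_unique => // [t|t /andP[t0 _]].
  exact: (cvgM (cvg_cst a) (cphi t)).
by apply: is_deriveZ; apply: is_derive_primitive => //; lra.
Qed.

Lemma averageB h phi psi : 0 < h -> continuous phi -> continuous psi ->
  average h (fun t => phi t - psi t) = average h phi - average h psi.
Proof.
move=> h0 cphi cpsi.
rewrite -[X in _ - X]mul1r -mulNr -averageZ// -averageD//.
  by congr average; apply/funext => t; rewrite mulN1r.
by move=> t; exact: (cvgM (cvg_cst (- 1 : R)) (cpsi t)).
Qed.

Lemma average_dist h phi (c e : R) : 0 < h -> continuous phi ->
  (forall t, 0 <= t <= h -> `|phi t - c| <= e) -> `|average h phi - c| <= e.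
Proof. by move=> h0 cphi phic; have [t th ->] := average_mean _ _ h0 cphi; exact: phic. Qed.

End average.

Section steklov.
Context {R : realType} {n : nat}.
Variable h : R.
Hypothesis h0 : 0 < h.
Implicit Types (f g : 'rV[R]_n -> R) (x v z : 'rV[R]_n) (i j : 'I_n) (s : seq 'I_n).

Local Notation e_ i := (delta_mx ord0 i : 'rV[R]_n).

Definition is_lipschitz f := exists L, forall x y, `|f x - f y| <= L * `|x - y|.

Definition steklov1 i f x : R := average h (fun t => f (x + t *: e_ i)).

Definition steklov s f : 'rV[R]_n -> R := foldr steklov1 f s.

Definition diff_quot i f x : R := (f (x + h *: e_ i) - f x) / h.

Lemma norm_delta_le i : `|e_ i| <= 1.
Proof.
apply/normrV_leP => // j; rewrite mxE.
by case: (_ && _); rewrite ?normr1 ?normr0.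
Qed.

Lemma norm_scale_delta_le (t : R) i : `|t *: e_ i| <= `|t|.
Proof. by rewrite normrZ ler_piMr// norm_delta_le. Qed.

Lemma is_lipschitz_ge0 f : is_lipschitz f ->
  exists2 L, 0 <= L & forall x y, `|f x - f y| <= L * `|x - y|.
Proof.
move=> [L fL]; exists `|L| => // x y; apply: (le_trans (fL x y)).
by rewrite ler_wpM2r// ler_norm.
Qed.

Lemma is_lipschitz_continuous f : is_lipschitz f -> continuous f.
Proof. by move=> [L fL]; exact: lipschitz_continuous fL. Qed.

Lemma continuous_line f x v : is_lipschitz f -> continuous (fun t : R => f (x + t *: v)).
Proof.
move=> /is_lipschitz_ge0[L L0 fL].
apply: (@lipschitz_continuous _ _ _ _ (L * `|v|)) => t t'.
apply: (le_trans (fL _ _)).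
by rewrite opprD addrACA subrr add0r -scalerBl normrZ -mulrA (mulrC `|v|).
Qed.

Lemma is_lipschitz_shift f v : is_lipschitz f -> is_lipschitz (fun x => f (x + v)).
Proof.
move=> [L fL]; exists L => x y; apply: (le_trans (fL _ _)).
by rewrite opprD addrACA subrr addr0.
Qed.

Lemma is_lipschitzD f g : is_lipschitz f -> is_lipschitz g ->
  is_lipschitz (fun x => f x + g x).
Proof.
move=> [L fL] [M gM]; exists (L + M) => x y.
rewrite opprD addrACA mulrDl.
by apply: (le_trans (ler_normD _ _)); rewrite lerD.
Qed.

Lemma is_lipschitzZ (a : R) f : is_lipschitz f -> is_lipschitz (fun x => a * f x).
Proof.
move=> [L fL]; exists (`|a| * L) => x y.
by rewrite -mulrBr normrM -mulrA ler_wpM2l.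
Qed.

Lemma is_lipschitz_diff_quot i f : is_lipschitz f -> is_lipschitz (diff_quot i f).
Proof.
move=> fL.
have -> : diff_quot i f = fun x => h^-1 * (f (x + h *: e_ i) + (-1) * f x).
  by apply/funext => x; rewrite /diff_quot mulN1r mulrC.
apply: is_lipschitzZ; apply: is_lipschitzD; first exact: is_lipschitz_shift.
exact: is_lipschitzZ.
Qed.

Lemma diff_quotC i j f : diff_quot i (diff_quot j f) = diff_quot j (diff_quot i f).
Proof.
apply/funext => x; rewrite /diff_quot (addrAC x (h *: e_ j)).
by lra.
Qed.

(** Averages commute with translations, so a bound on the increments by a fixed v survives with the
    same constant. Applied to each v, this preserves Lipschitz constants for any norm, in particular
    the Euclidean one. *)
Lemma steklov1_shift_le i f v (M : R) : is_lipschitz f ->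
  (forall x, `|f (x + v) - f x| <= M) ->
  forall x, `|steklov1 i f (x + v) - steklov1 i f x| <= M.
Proof.
move=> fL fM x; rewrite /steklov1 -averageB//; try exact: continuous_line.
rewrite -[average _ _]subr0; apply: average_dist => // [t|t _].
  by apply: continuousB; exact: continuous_line.
by rewrite subr0 addrAC; exact: fM.
Qed.

Lemma is_lipschitz_steklov1 i f : is_lipschitz f -> is_lipschitz (steklov1 i f).
Proof.
move=> fL; have [L Lf] := fL; exists L => x y.
have := @steklov1_shift_le i f (x - y) (L * `|x - y|) fL _ y.
rewrite (addrC y) subrK; apply => z.
by apply: (le_trans (Lf _ _)); rewrite addrAC subrr add0r.
Qed.

Lemma is_lipschitz_steklov s f : is_lipschitz f -> is_lipschitz (steklov s f).
Proof. by elim: s => //= i s IH fL; apply: is_lipschitz_steklov1; exact: IH. Qed.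

Lemma steklov_shift_le s f v (M : R) : is_lipschitz f ->
  (forall x, `|f (x + v) - f x| <= M) ->
  forall x, `|steklov s f (x + v) - steklov s f x| <= M.
Proof.
move=> fL fM; elim: s => //= i s IH; apply: steklov1_shift_le => //.
exact: is_lipschitz_steklov.
Qed.

Lemma steklov1_diff_quot i j f : is_lipschitz f ->
  steklov1 i (diff_quot j f) = diff_quot j (steklov1 i f).
Proof.
move=> fL; apply/funext => x.
rewrite /diff_quot /steklov1 -averageB//; try exact: continuous_line.
rewrite [RHS]mulrC -averageZ//; last first.
  by move=> t; apply: continuousB; exact: continuous_line.
congr average; apply/funext => t.
by rewrite mulrC (addrAC x).
Qed.

Lemma steklov_diff_quot s j f : is_lipschitz f ->
  steklov s (diff_quot j f) = diff_quot j (steklov s f).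
Proof.
move=> fL; elim: s => //= i s ->.
by rewrite steklov1_diff_quot//; exact: is_lipschitz_steklov.
Qed.

(** Each average moves the point by at most h in the sup norm, so the value at x involves f only
    within [size s] times h. *)
Lemma steklov_dist s f x (c e : R) : is_lipschitz f ->
  (forall y, `|y - x| <= (size s)%:R * h -> `|f y - c| <= e) ->
  `|steklov s f x - c| <= e.
Proof.
move=> fL; elim: s x => [|i s IH] x fc /=; first by apply: fc; rewrite subrr normr0 mul0r.
apply: average_dist => // [|t /andP[t0 th]].
  by apply: continuous_line; exact: is_lipschitz_steklov.
apply: IH => y yx; apply: fc.
rewrite (_ : y - x = (y - (x + t *: e_ i)) + t *: e_ i); last first.
  by rewrite opprD addrA subrK.
apply: (le_trans (ler_normD _ _)).
rewrite -natr1 mulrDl mul1r lerD// (le_trans (norm_scale_delta_le _ _))//.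
by rewrite ger0_norm.
Qed.

(* The error is quadratic, uniformly in the base point: such bounds pass to
   averages, whereas bare derivatives would need an exchange of limits. *)
Definition has_partial i f g := exists K : R, forall x (t : R), `|t| < 1 ->
  `|f (x + t *: e_ i) - f x - t * g x| <= K * t ^+ 2.

(** Shifting the segment by t adds a piece of length |t| at one end and removes one at the other, so
    the average changes by about t (phi h - phi 0) / h. At each end phi varies by at most L |t| over
    a length |t|, whence 2 L / h. *)
Lemma has_partial_steklov1 i f : is_lipschitz f ->
  has_partial i (steklov1 i f) (diff_quot i f).
Proof.
move=> fL; have [L L0 Lf] := is_lipschitz_ge0 _ fL; exists (2 * L / h) => x t t1.
pose phi u := f (x + u *: e_ i).
have cphi : continuous phi by exact: continuous_line.
have phiL a b : `|phi a - phi b| <= L * `|a - b|.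
  apply: (le_trans (Lf _ _)); rewrite ler_wpM2l//.
  by rewrite opprD addrACA subrr add0r -scalerBl norm_scale_delta_le.
have stE : steklov1 i f (x + t *: e_ i) =
    (primitive phi (h + t) - primitive phi (0 + t)) / h.
  rewrite /steklov1.
  apply: (@average_unique _ h _ (fun u => primitive phi (u + t))) => // [|u /andP[u0 uh]].
    exact: continuous_line.
  rewrite -addrA -scalerDl (addrC t).
  apply: is_derive_eq.
    apply: (@is_derive1_comp _ (primitive phi) (fun u => u + t)).
    apply: is_derive_primitive => //.
    by move: t1; rewrite ltr_norml => /andP[]; lra.
  by rewrite /phi addr0 mulr1.
(* The mean value theorem for either sign of t; |t| < 1 and a >= 0 keep the points above -1, where
   [primitive] is differentiable. *)
have mv (a : R) : 0 <= a ->
  exists2 c, `|c - a| <= `|t| & primitive phi (a + t) - primitive phi a = phi c * t.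
  move=> a0; move: t1; rewrite ltr_norml => /andP[t1 t2].
  have dP (u : R) : - 1 < u -> is_derive u 1 (primitive phi) (phi u).
    exact: is_derive_primitive.
  have [t0|t0] := leP 0 t.
    have [|u||c] := @MVT_segment _ (primitive phi) phi a (a + t).
    - by rewrite lerDl.
    - by rewrite in_itv/= => /andP[au _]; apply: dP; lra.
    - apply: derivable_within_continuous => u; rewrite in_itv/= => /andP[au _].
      by have [] := dP u ltac:(lra).
    rewrite in_itv/= => /andP[ac ca] ->; exists c; last by rewrite addrAC subrr add0r.
    by rewrite !ger0_norm ?subr_ge0//; lra.
  have [|u||c] := @MVT_segment _ (primitive phi) phi (a + t) a.
  - by rewrite gerDl ltW.
  - by rewrite in_itv/= => /andP[au _]; apply: dP; lra.
  - apply: derivable_within_continuous => u; rewrite in_itv/= => /andP[au _].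
    by have [] := dP u ltac:(lra).
  rewrite in_itv/= => /andP[ac ca] E; exists c.
    by rewrite !ler0_norm ?subr_le0 ?(ltW t0)//; lra.
  by rewrite -opprB E; lra.
have [c1 c1t E1] := mv h (ltW h0); have [c2 c2t E2] := mv 0 (lexx 0).
have st0E : steklov1 i f x = (primitive phi h - primitive phi 0) / h by [].
have dqE : diff_quot i f x = (phi h - phi 0) / h.
  by rewrite /diff_quot /phi scale0r addr0.
rewrite stE st0E dqE.
have {}E1 : primitive phi (h + t) = primitive phi h + phi c1 * t by rewrite -E1; lra.
have {}E2 : primitive phi (0 + t) = primitive phi 0 + phi c2 * t by rewrite -E2; lra.
rewrite E1 E2.
rewrite (_ : _ - t * _ = ((phi c1 - phi h) - (phi c2 - phi 0)) * t / h); last by lra.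
rewrite normrM normfV (gtr0_norm h0) [leRHS]mulrAC ler_wpM2r ?invr_ge0 ?(ltW h0)//.
rewrite normrM -real_normK ?num_real// expr2 mulrA ler_wpM2r//.
apply: (le_trans (ler_normB _ _)).
have := phiL c1 h; have := phiL c2 0.
have := ler_wpM2l L0 c1t; have := ler_wpM2l L0 c2t.
by lra.
Qed.

Lemma has_partial_steklov1_comp i j f g : is_lipschitz f -> is_lipschitz g ->
  has_partial i f g -> has_partial i (steklov1 j f) (steklov1 j g).
Proof.
move=> fL gL [K fg]; exists K => x t t1.
have l1 : continuous (fun u : R => f (x + t *: e_ i + u *: e_ j)) by exact: continuous_line.
have l2 : continuous (fun u : R => f (x + u *: e_ j)) by exact: continuous_line.
have l3 : continuous (fun u : R => g (x + u *: e_ j)) by exact: continuous_line.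
rewrite /steklov1 -averageB// -averageZ// -averageB//.
- rewrite -[average _ _]subr0; apply: average_dist => // [u|u _].
    exact: (cvgB (cvgB (l1 u) (l2 u)) (cvgM (cvg_cst t) (l3 u))).
  by rewrite subr0 (addrAC x); exact: fg.
- by move=> u; exact: (cvgB (l1 u) (l2 u)).
- by move=> u; exact: (cvgM (cvg_cst t) (l3 u)).
Qed.

(** The outermost average in direction i is spent on the derivative. The difference quotient that it
    leaves is moved inward through the averages below, and the averages above it carry the quadratic
    bound along. *)
Lemma has_partial_steklov s i f : is_lipschitz f -> i \in s ->
  has_partial i (steklov s f) (steklov (rem i s) (diff_quot i f)).
Proof.
move=> fL; elim: s => //= j s IH; rewrite inE.
have [->|ij] := eqVneq i j => /=.
  move=> _; rewrite steklov_diff_quot//.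
  by apply: has_partial_steklov1; exact: is_lipschitz_steklov.
move=> /IH ps.
apply: has_partial_steklov1_comp => //; first exact: is_lipschitz_steklov.
by apply: is_lipschitz_steklov; exact: is_lipschitz_diff_quot.
Qed.

End steklov.

Section steklov_gradient.
Context {R : realType} {n : nat}.
Implicit Types (f g : 'rV[R]_n -> R) (x z : 'rV[R]_n) (i j : 'I_n) (s : seq 'I_n).
Local Notation e_ i := (delta_mx ord0 i : 'rV[R]_n).

Lemma has_grad_quadratic f x q (C : R) : 0 <= C ->
  (forall z, `|z| < 1 -> `|f (x + z) - f x - dot q z| <= C * `|z| ^+ 2) ->
  has_grad f x q.
Proof.
move=> C0 fC e e0.
exists (Num.min (2^-1) (e / (C + 1))) => [|z].
  by rewrite lt_min invr_gt0 ltr0n/= divr_gt0// ltr_wpDl.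
rewrite le_min => /andP[z2 ze].
have z1 : `|z| < 1 by lra.
apply: (le_trans (fC z z1)); rewrite expr2 mulrA ler_wpM2r//.
apply: (@le_trans _ _ ((C + 1) * `|z|)); first by rewrite ler_wpM2r// lerDl.
by rewrite mulrC -ler_pdivlMr// ltr_wpDl.
Qed.

(** The increment is made one coordinate at a time. Each partial derivative is then taken at an
    intermediate point, and moving it back to x costs L [size s] |z|, times a coordinate of z: again
    a quadratic error. *)
Lemma has_partial_telescope f (G : 'I_n -> 'rV[R]_n -> R) s :
  (forall i, has_partial i f (G i)) -> (forall i, is_lipschitz (G i)) ->
  exists2 C : R, 0 <= C & forall x z, `|z| < 1 ->
    `|f (x + \sum_(i <- s) z ord0 i *: e_ i) - f x
      - \sum_(i <- s) G i x * z ord0 i| <= C * `|z| ^+ 2.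
Proof.
move=> fG GL; elim: s => [|j s [C C0 IH]].
  by exists 0 => // x z _; rewrite !big_nil addr0 !subrr normr0 mul0r.
have [K fK] := fG j.
have [L L0 GjL] := is_lipschitz_ge0 _ (GL j).
have K0 : 0 <= K.
  have := fK 0 2^-1; rewrite ger0_norm ?invr_ge0// => /(_ ltac:(lra)).
  by move=> /(le_trans (normr_ge0 _)); rewrite pmulr_lge0// exprn_gt0// invr_gt0.
exists (C + K + L * (size s)%:R) => [|x z z1].
  by rewrite !addr_ge0// mulr_ge0.
pose P := \sum_(i <- s) z ord0 i *: e_ i.
have Pz : `|P| <= (size s)%:R * `|z|.
  rewrite /P; elim: (s) => [|k s' IHs]; first by rewrite big_nil normr0 mul0r.
  rewrite big_cons /= -natr1 mulrDl mul1r addrC.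
  apply: (le_trans (ler_normD _ _)); rewrite lerD//.
  by apply: (le_trans (norm_scale_delta_le _ _)); exact: normrV_coord.
rewrite !big_cons -/P.
have zj := normrV_coord z j.
have h1 := fK (x + P) (z ord0 j) (le_lt_trans zj z1).
have h2 := IH x z z1; rewrite -/P in h2.
have h3 : `|(G j (x + P) - G j x) * z ord0 j| <= L * (size s)%:R * `|z| ^+ 2.
  rewrite normrM expr2 mulrA ler_pM//.
  apply: (le_trans (GjL _ _)); rewrite addrAC subrr add0r.
  by rewrite -mulrA ler_wpM2l.
have h4 : K * z ord0 j ^+ 2 <= K * `|z| ^+ 2.
  by rewrite ler_wpM2l// -real_normK ?num_real// ler_pXn2r ?nnegrE.
set S := \sum_(_ <- _) _ * _ in h2 *.
rewrite (_ : x + _ = x + P + z ord0 j *: e_ j); last by rewrite -addrA (addrC P).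
rewrite (_ : _ - _ = (f (x + P + z ord0 j *: e_ j) - f (x + P) - z ord0 j * G j (x + P))
   + (f (x + P) - f x - S) + (G j (x + P) - G j x) * z ord0 j); last by lra.
apply: (le_trans (ler_normD _ _)).
rewrite [leRHS]mulrDl lerD//.
apply: (le_trans (ler_normD _ _)).
by rewrite addrC [leRHS]mulrDl lerD// (le_trans h1).
Qed.

Lemma row_sum_scale_delta z : \sum_i z ord0 i *: e_ i = z.
Proof.
by rewrite [RHS]row_sum_delta.
Qed.

Lemma has_partial_has_grad f (G : 'I_n -> 'rV[R]_n -> R) :
  (forall i, has_partial i f (G i)) -> (forall i, is_lipschitz (G i)) ->
  forall x, has_grad f x (\row_i G i x).
Proof.
move=> fG GL x.
have [C C0 fC] := has_partial_telescope f G (index_enum 'I_n) fG GL.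
apply: (has_grad_quadratic _ _ _ _ C0) => z z1.
have := fC x z z1; rewrite row_sum_scale_delta.
by rewrite /dot; under [in X in _ -> X]eq_bigr do rewrite mxE.
Qed.

Variable h : R.
Hypothesis h0 : 0 < h.

Lemma has_grad_steklov s f x : is_lipschitz f -> (forall i, i \in s) ->
  has_grad (steklov h s f) x
    (\row_i steklov h (rem i s) (diff_quot h i f) x).
Proof.
move=> fL si.
apply: (has_partial_has_grad _ (fun i => steklov h (rem i s) (diff_quot h i f))) => i.
  exact: has_partial_steklov.
by apply: is_lipschitz_steklov => //; exact: is_lipschitz_diff_quot.
Qed.

Lemma remC (T : eqType) (a b : T) (l : seq T) : rem a (rem b l) = rem b (rem a l).
Proof.
elim: l => //= c l IH.
case: (altP (c =P a)) => [ca|ca]; case: (altP (c =P b)) => [cb|cb] //=.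
- by rewrite -ca -cb.
- by rewrite ca eqxx.
- by rewrite cb eqxx.
- by rewrite (negbTE ca) (negbTE cb) IH.
Qed.

(* Averaging twice in each direction yields C^2 functions; for lists without
   repetition only C^1 is obtained. *)
Definition double_enum : seq 'I_n := enum 'I_n ++ enum 'I_n.

Lemma mem_double_enum i : i \in double_enum.
Proof. by rewrite mem_cat mem_enum. Qed.

Lemma mem_rem_double_enum i j : j \in rem i double_enum.
Proof.
have /seq.permP/(_ (pred1 j))/= := perm_to_rem (mem_double_enum i).
rewrite /double_enum count_cat !enumT -enumT count_uniq_mem ?enum_uniq// mem_enum.
rewrite -has_pred1 has_count; case: eqP => _; case: count => //.
Qed.

Definition smooth f := steklov h double_enum f.
Definition smooth_partial i f := steklov h (rem i double_enum) (diff_quot h i f).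
Definition smooth_partial2 j i f :=
  steklov h (rem j (rem i double_enum)) (diff_quot h j (diff_quot h i f)).

(** The symmetry of second derivatives is pure algebra here: difference quotients commute, and so do
    removals from the list. *)
Lemma smooth_partial2C j i f : smooth_partial2 j i f = smooth_partial2 i j f.
Proof. by rewrite /smooth_partial2 remC diff_quotC. Qed.

Lemma has_grad_smooth f x : is_lipschitz f ->
  has_grad (smooth f) x (\row_i smooth_partial i f x).
Proof. by move=> fL; apply: has_grad_steklov => //; exact: mem_double_enum. Qed.

Lemma has_grad_smooth_partial i f x : is_lipschitz f ->
  has_grad (smooth_partial i f) x (\row_j smooth_partial2 j i f x).
Proof.
move=> fL; apply: has_grad_steklov; first exact: is_lipschitz_diff_quot.
exact: mem_rem_double_enum.
Qed.

Lemma is_lipschitz_smooth f : is_lipschitz f -> is_lipschitz (smooth f).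
Proof. exact: is_lipschitz_steklov. Qed.

Lemma is_lipschitz_smooth_partial i f : is_lipschitz f -> is_lipschitz (smooth_partial i f).
Proof. by move=> fL; apply: is_lipschitz_steklov => //; exact: is_lipschitz_diff_quot. Qed.

Lemma is_lipschitz_smooth_partial2 j i f : is_lipschitz f ->
  is_lipschitz (smooth_partial2 j i f).
Proof.
by move=> fL; apply: is_lipschitz_steklov => //; do 2! apply: is_lipschitz_diff_quot.
Qed.

End steklov_gradient.

(** The smoothed partial derivative averages difference quotients of f taken at points within a
    multiple of h of x with step h. Both ends of such a quotient are compared with the linear
    approximation at x, so differentiability at the single point x suffices. *)
Lemma cvg_smooth_partial {R : realType} {n : nat} (f : 'rV[R]_n -> R) x q i (e : R) :
  is_lipschitz f -> has_grad f x q -> 0 < e ->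
  exists2 d, 0 < d & forall h, 0 < h -> h <= d ->
    `|smooth_partial h i f x - q ord0 i| <= e.
Proof.
move=> fL fq e0.
pose s := rem i (@double_enum n); pose N : R := (size s)%:R.
have N0 : 0 <= N by rewrite ler0n.
(* Both ends lie within (N + 1) h of x, and the two remainders are divided by h: the total is 2 (N +
   1) times the tolerance. *)
have [d d0 dP] := fq (e / (2 * N + 2)) ltac:(by rewrite divr_gt0//; lra).
exists (d / (N + 1)) => [|h h0 hd]; first by rewrite divr_gt0//; lra.
have Nhd : (N + 1) * h <= d by rewrite mulrC -ler_pdivlMr//; lra.
apply: steklov_dist => //; first exact: is_lipschitz_diff_quot.
move=> y; rewrite -/s -/N => yx.
pose w := y - x; pose v := w + h *: delta_mx ord0 i.
have hv : `|v| <= (N + 1) * h.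
  rewrite mulrDl mul1r; apply: (le_trans (ler_normD _ _)); rewrite lerD//.
  by apply: (le_trans (norm_scale_delta_le _ _)); rewrite gtr0_norm.
have hw : `|w| <= (N + 1) * h by rewrite (le_trans yx)// ler_wpM2r ?ltW//; lra.
have hv' := dP v (le_trans hv Nhd); have hw' := dP w (le_trans hw Nhd).
have yE : y = x + w by rewrite /w addrC subrK.
rewrite /diff_quot yE -addrA -/v.
rewrite (_ : _ / h - _ = ((f (x + v) - f x - dot q v) - (f (x + w) - f x - dot q w)) /
  h); last first.
  rewrite /v dotDr dot_delta.
  rewrite (_ : f _ - f x - _ - _ = f (x + (w + h *: delta_mx ord0 i)) - f (x + w) - q
    ord0 i * h); last by lra.
  by rewrite [RHS]mulrBl mulfK ?gt_eqF.
rewrite normrM normfV (gtr0_norm h0) ler_pdivrMr//.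
apply: (le_trans (ler_normB _ _)).
have eN0 : 0 <= e / (2 * N + 2) by rewrite divr_ge0 ?ltW//; lra.
have := le_trans hv' (ler_wpM2l eN0 hv); have := le_trans hw' (ler_wpM2l eN0 hw).
have : e / (2 * N + 2) * ((N + 1) * h) * 2 = e * h.
  have N2 : 2 * N + 2 != 0 by rewrite gt_eqF//; lra.
  rewrite -[in RHS](divfK N2 e) -!mulrA; congr (_ * _).
  by set u := (_)^-1; lra.
by rewrite /=; lra.
Qed.

(** * Hadamard's inequality and alternating sums *)

Section gram.
Context {R : realFieldType}.

Lemma mulmx_tr_ge0 {N} (b : 'rV[R]_N) : 0 <= (b *m b^T) ord0 ord0.
Proof. by rewrite mxE; apply: sumr_ge0 => i _; rewrite mxE -expr2 sqr_ge0. Qed.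

Lemma mulmx_tr_eq0 {N} (b : 'rV[R]_N) : b *m b^T = 0 -> b = 0.
Proof.
move=> /matrixP/(_ ord0 ord0); rewrite !mxE => /eqP.
rewrite psumr_eq0 => [/allP b0|i _]; last by rewrite mxE -expr2 sqr_ge0.
apply/rowP => i; rewrite mxE; apply/eqP.
by have := b0 i (mem_index_enum i); rewrite mxE mulf_eq0 orbb.
Qed.

(** Induction on the number of rows, which is why the matrix is rectangular. Replacing the first row
    a by its component b orthogonal to the other rows leaves the Gram determinant unchanged, so it
    equals |b|^2 times that of the other rows, and |b| <= |a|. *)
Lemma hadamard_gram {m N} (A : 'M[R]_(m, N)) :
  0 <= \det (A *m A^T) <= \prod_i (A *m A^T) i i.
Proof.
elim: m A => [|m IH] A; first by rewrite det_mx00 big_ord0 ler01 lexx.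
pose a : 'rV[R]_N := usubmx (A : 'M[R]_(1 + m, N)).
pose B : 'M[R]_(m, N) := dsubmx (A : 'M[R]_(1 + m, N)).
have AE : A = col_mx a B by rewrite vsubmxK.
have AAE : A *m A^T = block_mx (a *m a^T) (a *m B^T) (B *m a^T) (B *m B^T).
  by rewrite [in LHS]AE (@tr_col_mx _ 1 m N) (@mul_col_row _ 1 m N 1 m).
have prodE : \prod_i (A *m A^T) i i =
    (a *m a^T) ord0 ord0 * \prod_i (B *m B^T) i i.
  rewrite big_ord_recl AAE; congr (_ * _).
    rewrite (_ : ord0 = lshift m (ord0 : 'I_1)); last exact: val_inj.
    by rewrite (@block_mxEul _ 1 m 1 m).
  apply: eq_bigr => i _; rewrite (_ : lift ord0 i = rshift 1 i); last exact: val_inj.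
  by rewrite (@block_mxEdr _ 1 m 1 m).
rewrite prodE.
have /andP[G0 Gle] := IH B.
set G := B *m B^T in G0 Gle AAE *.
have aa0 := mulmx_tr_ge0 a.
(* If the Gram matrix of the remaining rows is singular, these rows are dependent, since |v B|^2 = v
   G v^T = 0; then the whole determinant vanishes. *)
have [/eqP/det0P[v v0 vG]|Gn0] := eqVneq (\det G) 0.
  have vA : v *m B = 0.
    by apply: mulmx_tr_eq0; rewrite trmx_mul mulmxA -(mulmxA v) vG mul0mx.
  suff -> : \det (A *m A^T) = 0 by rewrite lexx/= mulr_ge0// (le_trans G0).
  apply/eqP/det0P; exists (row_mx (0 : 'rV_1) v : 'rV_(1 + m)).
    apply: contra v0 => /eqP vv; apply/eqP.
    have := row_mxKr (0 : 'rV[R]_1) v; rewrite vv => <-.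
    by apply/rowP => i; rewrite !mxE.
  rewrite mulmxA AE (@mul_row_col _ 1 1 m N) mul0mx add0r vA.
  by rewrite mul0mx.
have uG : G \in unitmx by rewrite unitmxE unitfE.
(* The coefficients of the orthogonal projection of a onto the span of the rows of B. *)
pose c := a *m B^T *m invmx G.
pose b := a - c *m B.
have bA : b *m B^T = 0.
  by rewrite mulmxBl -mulmxA -/G mulmxKV// subrr.
have Ab : B *m b^T = 0 by rewrite -[LHS]trmxK trmx_mul trmxK bA trmx0.
have aE : a = b + c *m B by rewrite subrK.
have aaE : a *m a^T = b *m b^T + (c *m B) *m (c *m B)^T.
  rewrite {1 2}aE mulmxDl raddfD/= !mulmxDr.
  have -> : b *m (c *m B)^T = 0 by rewrite trmx_mul mulmxA bA mul0mx.
  have -> : c *m B *m b^T = 0 by rewrite -mulmxA Ab mulmx0.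
  by rewrite addr0 add0r.
have det_eq : \det (A *m A^T) = (b *m b^T) ord0 ord0 * \det G.
  pose L : 'M[R]_(1 + m) := block_mx 1%:M c 0 1%:M.
  have detL : \det L = 1 by rewrite det_ublock !det1 mulr1.
  have : A *m A^T = L *m block_mx (b *m b^T) 0 0 G *m L^T.
    rewrite AAE /L tr_block_mx !mulmx_block !trmx1 !trmx0.
    rewrite !mul1mx !mul0mx !mulmx0 !mulmx1 !addr0 !add0r.
    have -> : a *m a^T = b *m b^T + c *m G *m c^T.
      by rewrite aaE trmx_mul mulmxA -(mulmxA c).
    have -> : a *m B^T = c *m G by rewrite {1}aE mulmxDl bA add0r -mulmxA.
    suff -> : B *m a^T = G *m c^T by [].
    by rewrite aE raddfD/= mulmxDr Ab add0r trmx_mul mulmxA.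
  move=> ->; rewrite !det_mulmx det_tr detL mul1r mulr1 (@det_ublock _ 1 m).
  by rewrite [X in \det X * _ = _]mx11_scalar det_scalar1.
have bb0 := mulmx_tr_ge0 b.
rewrite det_eq mulr_ge0//=.
apply: ler_pM => //.
by rewrite aaE [leRHS]mxE lerDl mulmx_tr_ge0.
Qed.

Lemma hadamard {n} (A : 'M[R]_n) : (\det A) ^+ 2 <= \prod_i \sum_j A i j ^+ 2.
Proof.
have /andP[_] := hadamard_gram A.
rewrite det_mulmx det_tr -expr2 => /le_trans; apply.
apply: ler_prod => i _.
have -> : (A *m A^T) i i = \sum_j A i j ^+ 2.
  by rewrite mxE; apply: eq_bigr => j _; rewrite mxE expr2.
by rewrite lexx andbT; apply: sumr_ge0 => j _; rewrite sqr_ge0.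
Qed.

End gram.

Section minor_sum.
Context {R : comNzRingType} {n : nat}.
Implicit Types (G : 'I_n.+1 -> 'I_n -> R) (s : 'S_n.+1).

(* The signed minor of the matrix (x_i, G i k) along its first column x: the i-th
   component of the vector dual to dg^1 /\ ... /\ dg^n when G i k = d_i g^k. *)
Definition minor_sum G (i : 'I_n.+1) : R :=
  \sum_(s : 'S_n.+1 | s ord0 == i) (-1) ^+ s * \prod_k G (s (lift ord0 k)) k.

Lemma det_minor_sum (M : 'M[R]_n.+1) :
  \det M = \sum_i M i ord0 * minor_sum (fun i k => M i (lift ord0 k)) i.
Proof.
rewrite -det_tr /determinant (partition_big (fun s : 'S_n.+1 => s ord0) xpredT)//=.
apply: eq_bigr => i _; rewrite /minor_sum mulr_sumr.
apply: eq_bigr => s /eqP si.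
rewrite big_ord_recl mxE si mulrCA; congr (_ * (_ * _)).
by apply: eq_bigr => k _; rewrite mxE.
Qed.

(* The permutations s and tperm 0 k.+1 * s give opposite terms. *)
Lemma alternating_sum_eq0 (H : 'I_n.+1 -> 'I_n.+1 -> 'I_n -> R) G :
  (forall i j k, H i j k = H j i k) ->
  \sum_(s : 'S_n.+1) (-1) ^+ s * \sum_k (H (s ord0) (s (lift ord0 k)) k *
     \prod_(l | l != k) G (s (lift ord0 l)) l) = 0.
Proof.
move=> Hsym.
under eq_bigr do rewrite mulr_sumr.
rewrite exchange_big/= big1// => k _.
pose t := tperm ord0 (lift ord0 k : 'I_n.+1).
pose F (s : 'S_n.+1) : R := (-1) ^+ s * (H (s ord0) (s (lift ord0 k)) k *
     \prod_(l | l != k) G (s (lift ord0 l)) l).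
have Ft s : F (t * s)%g = - F s.
  rewrite /F odd_mul_tperm neq_lift/= signrN mulNr; congr (- (_ * (_ * _))).
    by rewrite !permM tpermL tpermR Hsym.
  apply: eq_bigr => l lk; rewrite permM tpermD// ?neq_lift//.
  by rewrite (inj_eq lift_inj) eq_sym.
rewrite (bigID (fun s : 'S_n.+1 => odd_perm s))/=.
rewrite (reindex_inj (mulgI t))/=.
under eq_bigr do rewrite -/(F _) Ft.
rewrite sumrN addrC; apply/eqP; rewrite subr_eq0; apply/eqP.
by apply: eq_bigl => s; rewrite odd_mul_tperm neq_lift.
Qed.

End minor_sum.

(** With the vector c of minors put in as first column, the determinant is |c|^2. Hadamard's
    inequality gives |c|^4 <= |c|^2 P, where P is the right-hand side, and one factor |c|^2
    cancels. *)
Lemma minor_sum_sqr_le {R : realFieldType} {n : nat} (G : 'I_n.+1 -> 'I_n -> R) :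
  \sum_i minor_sum G i ^+ 2 <= \prod_k \sum_i G i k ^+ 2.
Proof.
set c := minor_sum G.
pose M : 'M[R]_n.+1 := \matrix_(i, j) oapp (G i) (c i) (unlift ord0 j).
have M0 i : M i ord0 = c i by rewrite mxE unlift_none.
have MS i k : M i (lift ord0 k) = G i k by rewrite mxE liftK.
have detM : \det M = \sum_i c i ^+ 2.
  rewrite det_minor_sum; apply: eq_bigr => i _; rewrite M0 expr2; congr (_ * _).
  by congr minor_sum; apply/funext => j; apply/funext => k; rewrite MS.
set S := \sum_i _; set P := \prod_k _.
have := hadamard M^T; rewrite det_tr detM -/S.
have -> : \prod_i \sum_j M^T i j ^+ 2 = S * P.
  rewrite big_ord_recl; congr (_ * _).
    by apply: eq_bigr => i _; rewrite mxE M0.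
  by apply: eq_bigr => k _; apply: eq_bigr => i _; rewrite mxE MS.
have S0 : 0 <= S by apply: sumr_ge0 => i _; rewrite sqr_ge0.
have P0 : 0 <= P by apply: prodr_ge0 => k _; apply: sumr_ge0 => i _; rewrite sqr_ge0.
have [->//|Sn0] := eqVneq S 0.
by rewrite expr2 ler_pM2l// lt_neqAle eq_sym Sn0.
Qed.

(** * The field f cof(Dg) *)

Lemma near_continuous (T S : topologicalType) (f g : T -> S) (x : T) (U : set T) :
  nbhs x U -> (forall y, U y -> f y = g y) ->
  {for x, continuous f} -> {for x, continuous g}.
Proof.
move=> nU fg cf A; rewrite -(fg x (nbhs_singleton nU)) => /cf fA.
by apply: filterS (filterI nU fA) => y [Uy]; rewrite /= fg.
Qed.

Section big_derive.
Context {R : realType} {V : normedModType R}.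

Lemma is_derive_bigsum (I : Type) (r : seq I) (P : pred I) (F : I -> V -> R)
    (dF : I -> R) (x v : V) :
  (forall i, is_derive x v (F i) (dF i)) ->
  is_derive x v (fun y => \sum_(i <- r | P i) F i y) (\sum_(i <- r | P i) dF i).
Proof.
move=> FdF; elim: r => [|i r IH].
  rewrite big_nil (_ : (fun _ => _) = cst 0); first exact: is_derive_cst.
  by apply/funext => y; rewrite big_nil.
rewrite big_cons; case: ifP => Pi; last first.
  rewrite (_ : (fun _ => _) = (fun y => \sum_(i <- r | P i) F i y))//.
  by apply/funext => y; rewrite big_cons Pi.
rewrite (_ : (fun _ => _) = F i + (fun y => \sum_(i <- r | P i) F i y)); last first.
  by apply/funext => y; rewrite big_cons Pi.
exact: is_deriveD.
Qed.

Lemma is_derive_bigprod (I : eqType) (r : seq I) (F : I -> V -> R)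
    (dF : I -> R) (x v : V) : uniq r ->
  (forall i, is_derive x v (F i) (dF i)) ->
  is_derive x v (fun y => \prod_(i <- r) F i y)
    (\sum_(i <- r) dF i * \prod_(l <- r | l != i) F l x).
Proof.
move=> + FdF; elim: r => [_|i r IH /= /andP[ir ur]].
  rewrite big_nil (_ : (fun _ => _) = cst 1); first exact: is_derive_cst.
  by apply/funext => y; rewrite big_nil.
rewrite (_ : (fun _ => _) = F i * (fun y => \prod_(i <- r) F i y)); last first.
  by apply/funext => y; rewrite big_cons.
have h := is_deriveM (FdF i) (IH ur).
apply: is_derive_eq.
rewrite big_cons addrC; congr (_ + _).
  rewrite [LHS]mulrC /GRing.scale/= big_cons eqxx/=; congr (_ * _).
  rewrite big_seq_cond [RHS]big_seq_cond; apply: eq_bigl => l; rewrite andbT.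
  by case: (boolP (l \in r)) => //= lr; apply/esym; apply: contra ir => /eqP <-.
rewrite /GRing.scale/= mulr_sumr; apply: eq_big_seq => k kr.
rewrite big_cons mulrCA; case: eqVneq => // ik.
by move: ir; rewrite ik kr.
Qed.

Lemma differentiable_bigsum (I : Type) (r : seq I) (P : pred I) (F : I -> V -> R) (x : V) :
  (forall i, differentiable (F i) x) ->
  differentiable (fun y => \sum_(i <- r | P i) F i y) x.
Proof.
move=> dF; elim: r => [|i r IH].
  rewrite (_ : (fun _ => _) = cst 0); first exact: differentiable_cst.
  by apply/funext => y; rewrite big_nil.
case: (boolP (P i)) => Pi; last first.
  rewrite (_ : (fun _ => _) = (fun y => \sum_(i <- r | P i) F i y))//.
  by apply/funext => y; rewrite big_cons (negbTE Pi).
rewrite (_ : (fun _ => _) = F i + (fun y => \sum_(i <- r | P i) F i y)); last first.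
  by apply/funext => y; rewrite big_cons Pi.
exact: differentiableD.
Qed.

Lemma differentiable_bigprod (I : Type) (r : seq I) (F : I -> V -> R) (x : V) :
  (forall i, differentiable (F i) x) ->
  differentiable (fun y => \prod_(i <- r) F i y) x.
Proof.
move=> dF; elim: r => [|i r IH].
  rewrite (_ : (fun _ => _) = cst 1); first exact: differentiable_cst.
  by apply/funext => y; rewrite big_nil.
rewrite (_ : (fun _ => _) = F i * (fun y => \prod_(i <- r) F i y)); last first.
  by apply/funext => y; rewrite big_cons.
exact: differentiableM.
Qed.

Lemma continuous_bigsum (T : topologicalType) (I : Type) (r : seq I) (P : pred I) (F :
  I -> T -> R) :
  (forall i, continuous (F i)) -> continuous (fun y => \sum_(i <- r | P i) F i y).
Proof. by move=> cF x; apply: cvg_big => [|i _]; [exact: add_continuous|exact: cF]. Qed.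

Lemma continuous_bigprod (T : topologicalType) (I : Type) (r : seq I) (P : pred I) (F :
  I -> T -> R) :
  (forall i, continuous (F i)) -> continuous (fun y => \prod_(i <- r | P i) F i y).
Proof. by move=> cF x; apply: cvg_big => [|i _]; [exact: mul_continuous|exact: cF]. Qed.

Lemma cvg_mx_entries (T : Type) (F : set_system T) (FF : Filter F) m n
    (M : T -> 'M[R]_(m, n)) (A : 'M[R]_(m, n)) :
  (forall i j, M x i j @[x --> F] --> A i j) -> M x @[x --> F] --> A.
Proof.
move=> MA; apply/cvgrPdist_le => /= e e0; near=> x.
rewrite /Num.Def.normr/= mx_normrE (bigmax_le _ (ltW e0))//= => i _.
rewrite !mxE/=.
move: i; near: x; apply: filter_forall => /= i.
exact: ((cvgrPdist_le _ _).1 (MA i.1 i.2)).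
Unshelve. all: by end_near. Qed.

Lemma continuous_mx (T : topologicalType) m n (M : T -> 'M[R]_(m, n)) (x : T) :
  (forall i j, {for x, continuous (fun y => M y i j)}) -> {for x, continuous M}.
Proof. by move=> Mx; exact: (@cvg_mx_entries _ (nbhs x) _ _ _ M (M x) Mx). Qed.

Lemma differentiable_rV n (F : V -> 'rV[R]_n) (x : V) :
  (forall j, differentiable (fun y => F y ord0 j) x) -> differentiable F x.
Proof.
move=> dF.
rewrite (_ : F = \sum_(j < n) (fun y => F y ord0 j *: delta_mx ord0 j)).
  by apply: differentiable_sum => j; exact: differentiableZl.
by apply/funext => y; rewrite fct_sumE -row_sum_delta.
Qed.

Lemma differentiable_component n (F : V -> 'rV[R]_n) (x : V) j :
  differentiable F x -> differentiable (fun y => F y ord0 j) x.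
Proof.
move=> dF.
exact: (differentiable_comp dF (differentiable_coord (F x) ord0 j)).
Qed.

End big_derive.

Lemma jacobianE {R : realType} m n (F : 'rV[R]_m -> 'rV[R]_n) x i j :
  (forall j, differentiable (fun y => F y ord0 j) x) ->
  'J F x i j = 'D_(delta_mx ord0 i) (fun y => F y ord0 j) x.
Proof.
move=> dF; have dFx := differentiable_rV _ _ _ dF.
rewrite /jacobian mxE -deriveE// derive_mx ?mxE//.
exact: diff_derivable.
Qed.

Section divergence_field.
Context {R : realType} {n : nat}.
Variables (h : R) (f : 'rV[R]_n.+1 -> R) (g : 'I_n -> 'rV[R]_n.+1 -> R).
Hypotheses (h0 : 0 < h) (fL : is_lipschitz f) (gL : forall k, is_lipschitz (g k)).
Implicit Types (x : 'rV[R]_n.+1) (i j : 'I_n.+1) (k : 'I_n).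

Local Notation e_ i := (delta_mx ord0 i : 'rV[R]_n.+1).
Let F := smooth h f.
Let dF i := smooth_partial h i f.
Let G i k := smooth_partial h i (g k).
Let dG j i k := smooth_partial2 h j i (g k).

Let minor i x := minor_sum (fun i k => G i k x) i.

Definition minor_field x : 'rV[R]_n.+1 := \row_i (F x * minor i x).

Let dminor j i x := \sum_(s : 'S_n.+1 | s ord0 == i) (-1) ^+ s *
  \sum_k dG j (s (lift ord0 k)) k x * \prod_(l | l != k) G (s (lift ord0 l)) l x.

Let differentiableF x : differentiable F x.
Proof. by have [] := has_grad_is_diff _ _ _ (has_grad_smooth h h0 f x fL). Qed.

Let differentiableG i k x : differentiable (G i k) x.
Proof.
by have [] := has_grad_is_diff _ _ _ (has_grad_smooth_partial h h0 i (g k) x (gL k)).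
Qed.

Let is_deriveF i x : is_derive x (e_ i) F (dF i x).
Proof.
apply: DeriveDef; first exact: diff_derivable.
by rewrite (has_grad_derive _ _ _ _ (has_grad_smooth h h0 f x fL)) mxE.
Qed.

Let is_deriveG j i k x : is_derive x (e_ j) (G i k) (dG j i k x).
Proof.
apply: DeriveDef; first exact: diff_derivable.
by rewrite (has_grad_derive _ _ _ _ (has_grad_smooth_partial h h0 i (g k) x (gL k))) mxE.
Qed.

Let differentiable_minor i x : differentiable (minor i) x.
Proof.
apply: differentiable_bigsum => s; apply: (@differentiableM _ _ (cst _)) => //.
by apply: differentiable_bigprod => k; exact: differentiableG.
Qed.

Let is_derive_minor j i x : is_derive x (e_ j) (minor i) (dminor j i x).
Proof.
apply: is_derive_bigsum => s.
apply: (@is_deriveZ _ _ _ (fun y => \prod_k G (s (lift ord0 k)) k y)).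
apply: is_derive_bigprod => [|k]; first exact: index_enum_uniq.
exact: is_deriveG.
Qed.

Lemma differentiable_minor_field x i : differentiable (fun y => minor_field y ord0 i) x.
Proof.
rewrite (_ : (fun _ => _) = F * minor i); first exact: differentiableM.
by apply/funext => y; rewrite mxE.
Qed.

Lemma is_derive_minor_field j i x :
  is_derive x (e_ j) (fun y => minor_field y ord0 i)
    (dF j x * minor i x + F x * dminor j i x).
Proof.
rewrite (_ : (fun _ => _) = F * minor i); last by apply/funext => y; rewrite mxE.
have h1 := is_deriveM (is_deriveF j x) (is_derive_minor j i x).
by apply: is_derive_eq; rewrite /GRing.scale/= addrC (mulrC (dF j x)).
Qed.

(* The derivatives of the minors cancel by symmetry of the second derivatives. *)
Lemma divergence_minor_field x :
  divergence minor_field x = \sum_i smooth_partial h i f x *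
    minor_sum (fun i k => smooth_partial h i (g k) x) i.
Proof.
rewrite /divergence.
under eq_bigr do rewrite (@derive_val _ _ _ _ _ _ _ (is_derive_minor_field _ _ x)).
rewrite big_split/= -mulr_sumr -[RHS]addr0; congr (_ + _).
rewrite -[RHS](mulr0 (F x)); congr (_ * _).
rewrite -[RHS](@alternating_sum_eq0 _ _ (fun i j k => dG i j k x) (fun i k => G i k x)).
  rewrite [RHS](partition_big (fun s : 'S_n.+1 => s ord0) xpredT)//=.
  by apply: eq_bigr => i _; apply: eq_bigr => s /eqP ->.
by move=> i j k; rewrite /dG smooth_partial2C.
Qed.

Lemma differentiable_minor_fieldT x : differentiable minor_field x.
Proof. by apply: differentiable_rV => j; exact: differentiable_minor_field. Qed.

Lemma continuous_jacobian_minor_field : continuous (fun y => 'J minor_field y).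
Proof.
have cF : continuous F by apply: is_lipschitz_continuous; exact: is_lipschitz_smooth.
have cdF i : continuous (dF i).
  by apply: is_lipschitz_continuous; exact: is_lipschitz_smooth_partial.
have cG i k : continuous (G i k).
  by apply: is_lipschitz_continuous; exact: is_lipschitz_smooth_partial.
have cdG j i k : continuous (dG j i k).
  by apply: is_lipschitz_continuous; exact: is_lipschitz_smooth_partial2.
have cM i : continuous (minor i).
  apply: continuous_bigsum => s x.
  have cP : continuous (fun y => \prod_k G (s (lift ord0 k)) k y).
    by apply: continuous_bigprod => k; exact: cG.
  exact: (cvgM (cvg_cst ((-1) ^+ s : R)) (cP x)).
have cdM j i : continuous (dminor j i).
  apply: continuous_bigsum => s x.
  have cS : continuous (fun y => \sum_k dG j (s (lift ord0 k)) k y *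
      \prod_(l | l != k) G (s (lift ord0 l)) l y).
    apply: continuous_bigsum => k y.
    have cP : continuous (fun y => \prod_(l | l != k) G (s (lift ord0 l)) l y).
      by apply: continuous_bigprod => l; exact: cG.
    exact: (cvgM (cdG j (s (lift ord0 k)) k y) (cP y)).
  exact: (cvgM (cvg_cst ((-1) ^+ s : R)) (cS x)).
move=> x; apply: continuous_mx => j i.
have JE y : 'J minor_field y j i = dF j y * minor i y + F y * dminor j i y.
  rewrite jacobianE; last exact: differentiable_minor_field.
  exact: (@derive_val _ _ _ _ _ _ _ (is_derive_minor_field _ _ y)).
rewrite (_ : (fun _ => _) = fun y => dF j y * minor i y + F y * dminor j i y).
  exact: (cvgD (cvgM (cdF j x) (cM i x)) (cvgM (cF x) (cdM j i x))).
by apply/funext => y; exact: JE.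
Qed.

End divergence_field.

(** * Euclidean norm and Lipschitz extensions *)

Section euclidean_norm.
Context {R : realType} {n : nat}.
Implicit Types (x y z q : 'rV[R]_n).

Lemma enorm_ge0 x : 0 <= enorm x.
Proof. exact: sqrtr_ge0. Qed.

Lemma sqr_enorm x : enorm x ^+ 2 = dot x x.
Proof.
rewrite /enorm sqr_sqrtr; last by apply: sumr_ge0 => i _; rewrite sqr_ge0.
by apply: eq_bigr => i _; rewrite expr2.
Qed.

Lemma normrV_le_enorm x : `|x| <= enorm x.
Proof.
apply/normrV_leP => [|i]; first exact: enorm_ge0.
rewrite -sqrtr_sqr ler_sqrt; last by apply: sumr_ge0 => j _; rewrite sqr_ge0.
by rewrite (bigD1 i)//= lerDl; apply: sumr_ge0 => j _; rewrite sqr_ge0.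
Qed.

Lemma enorm_le_normrV x : enorm x <= n%:R * `|x|.
Proof.
have nx0 : 0 <= n%:R * `|x| by rewrite mulr_ge0.
rewrite -(@ler_pXn2r _ 2) ?nnegrE ?enorm_ge0// sqr_enorm.
apply: (@le_trans _ _ (n%:R * `|x| ^+ 2)).
  rewrite mulr_natl -[X in _ *+ X]card_ord -sumr_const; apply: ler_sum => i _.
  by rewrite -expr2 -real_normK ?num_real// ler_pXn2r ?nnegrE// normrV_coord.
rewrite exprMn ler_wpM2r ?exprn_ge0// expr2 -natrM ler_nat.
by case: (n) => // m; rewrite leq_pmulr.
Qed.

Lemma enormN x : enorm (- x) = enorm x.
Proof. by congr Num.sqrt; apply: eq_bigr => i _; rewrite mxE sqrrN. Qed.

Lemma enormZ (t : R) x : 0 <= t -> enorm (t *: x) = t * enorm x.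
Proof.
move=> t0; rewrite /enorm -[t in RHS]ger0_norm// -sqrtr_sqr -sqrtrM ?sqr_ge0//.
by rewrite mulr_sumr; congr Num.sqrt; apply: eq_bigr => i _; rewrite mxE exprMn.
Qed.

Lemma cauchy_schwarz x y : `|dot x y| <= enorm x * enorm y.
Proof.
have [y0|y0] := eqVneq (enorm y) 0.
  have : `|y| <= 0 by rewrite (le_trans (normrV_le_enorm y))// y0.
  rewrite normr_le0 => /eqP ->.
  rewrite /dot big1 ?normr0 ?mulr_ge0 ?enorm_ge0// => i _.
  by rewrite mxE mulr0.
have ey : 0 < enorm y by rewrite lt_neqAle eq_sym y0 enorm_ge0.
rewrite -(@ler_pXn2r _ 2) ?nnegrE ?mulr_ge0 ?enorm_ge0//.
rewrite real_normK ?num_real// exprMn !sqr_enorm.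
have yy : 0 < dot y y by rewrite -sqr_enorm exprn_gt0.
pose t := dot x y / dot y y.
have dC (u v : 'rV[R]_n) : dot u v = dot v u by apply: eq_bigr => i _; rewrite mulrC.
have dZ (u v : 'rV[R]_n) : dot (t *: u) v = t * dot u v.
  by rewrite /dot mulr_sumr; apply: eq_bigr => i _; rewrite mxE mulrA.
have : 0 <= dot (x - t *: y) (x - t *: y) by rewrite -sqr_enorm exprn_ge0// enorm_ge0.
rewrite dotBl (dC x) (dC (t *: y)) !dotBl !dZ (dC x (t *: y)) (dC y (t *: y)) !dZ (dC y x).
have -> : t * dot y y = dot x y by rewrite /t divfK// gt_eqF.
rewrite subrr subr0 subr_ge0 /t mulrAC ler_pdivrMr//.
Qed.

Lemma ler_enormD x y : enorm (x + y) <= enorm x + enorm y.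
Proof.
rewrite -(@ler_pXn2r _ 2) ?nnegrE ?addr_ge0 ?enorm_ge0// sqr_enorm.
rewrite dotDr !dotDl sqrrD !sqr_enorm.
have := cauchy_schwarz x y; have := cauchy_schwarz y x.
rewrite !ler_norml => /andP[_ h1] /andP[_ h2].
by rewrite (mulrC (enorm y)) in h1; lra.
Qed.

(** Along q itself the linear part of the increment t q is t |q|^2, whereas f varies by at most t
    |q|. The choice t = d / |q| gives the increment Euclidean length d, hence sup norm at most d. *)
Lemma has_grad_enorm_le1 (f : 'rV[R]_n -> R) x q :
  (forall y z, `|f y - f z| <= enorm (y - z)) -> has_grad f x q -> enorm q <= 1.
Proof.
move=> fL fq.
have [q0|q0] := eqVneq (enorm q) 0; first by rewrite q0.
have eq0 : 0 < enorm q by rewrite lt_neqAle eq_sym q0 enorm_ge0.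
apply/ler_addgt0Pr => e e0.
have [d d0 dP] := fq e e0.
pose t := d / enorm q.
have t0 : 0 < t by rewrite divr_gt0.
have ntq : `|t *: q| <= d.
  rewrite (le_trans (normrV_le_enorm _))// enormZ ?(ltW t0)//.
  by rewrite /t divfK ?gt_eqF.
have := dP _ ntq; have := fL (x + t *: q) x;
  rewrite addrAC subrr add0r enormZ ?(ltW t0)// => h1 h2.
have dZ : dot q (t *: q) = t * enorm q ^+ 2.
  by rewrite sqr_enorm /dot mulr_sumr; apply: eq_bigr => i _; rewrite mxE mulrCA.
have h3 : `|t *: q| <= t * enorm q.
  by rewrite (le_trans (normrV_le_enorm _))// enormZ ?(ltW t0).
move: h2; rewrite dZ /= => h2.
have h4 : t * enorm q ^+ 2 <= t * enorm q + e * (t * enorm q).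
  have := ler_wpM2l (ltW e0) h3.
  move: h1 h2; rewrite !ler_norml => /andP[h1 h1'] /andP[h2 h2']; lra.
have tq : 0 < t * enorm q by rewrite mulr_gt0.
rewrite -(ler_pM2l tq); move: h4; rewrite expr2; lra.
Qed.

End euclidean_norm.

Section lipschitz_extension.
Context {R : realType} {n : nat}.
Implicit Types (U K : set 'rV[R]_n.+1) (f g : 'rV[R]_n.+1 -> R) (x y z : 'rV[R]_n.+1).

Lemma lip_leP (a L : R) U f : 0 <= L -> (lip a U f <= L%:E)%E ->
  forall x y, U x -> U y -> `|f x - f y| <= L * enorm (x - y) `^ a.
Proof.
move=> L0 fL x y Ux Uy.
have [->|xy] := eqVneq x y.
  by rewrite subrr normr0 mulr_ge0 ?powR_ge0.
have e0 : 0 < enorm (x - y).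
  rewrite (lt_le_trans _ (normrV_le_enorm _))// normr_gt0 subr_eq0.
  exact: xy.
rewrite -ler_pdivrMr ?powR_gt0// -lee_fin; apply: le_trans fL.
by apply: ereal_sup_ubound; exists (x, y).
Qed.

Lemma lip1_leP U f : (lip 1 U f <= 1)%E ->
  forall x y, U x -> U y -> `|f x - f y| <= enorm (x - y).
Proof.
move=> fL x y Ux Uy; have := lip_leP _ _ _ _ ler01 fL x y Ux Uy.
by rewrite mul1r powRr1 ?enorm_ge0.
Qed.

Lemma Lip_ex U f : Lip U f -> exists2 L, 0 <= L &
  forall x y, U x -> U y -> `|f x - f y| <= L * enorm (x - y).
Proof.
rewrite /Lip /= => fL.
have [L L0 fLL] : exists2 L, 0 <= L & (lip 1 U f <= L%:E)%E.
  (* The value -oo occurs when U has no two distinct points. *)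
  case: (lip 1 U f) fL => [r _|//|_]; last by exists 0; rewrite ?leNye.
  by exists `|r| => //; rewrite lee_fin ler_norm.
exists L => // x y Ux Uy; have := lip_leP _ _ _ _ L0 fLL x y Ux Uy.
by rewrite powRr1 ?enorm_ge0.
Qed.

Lemma mcshane U g z : U z ->
  (forall x y, U x -> U y -> `|g x - g y| <= enorm (x - y)) ->
  exists2 g', (forall x, U x -> g' x = g x) &
    forall x y, `|g' x - g' y| <= enorm (x - y).
Proof.
move=> Uz gL.
pose A x := [set g y + enorm (x - y) | y in U].
have tri x x' y : enorm (x - y) <= enorm (x - x') + enorm (x' - y).
  by rewrite -[x - y](subrKA x') ler_enormD.
have Ane x : A x !=set0 by exists (g z + enorm (x - z)), z.
have Alb x : has_lbound (A x).
  exists (g z - enorm (x - z)) => _ [y Uy <-].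
  have := gL z y Uz Uy; have := tri z x y; rewrite -(enormN (z - x)) opprB.
  by rewrite ler_norml => h1 /andP[_ h2]; lra.
have hlt x x' : inf (A x) <= inf (A x') + enorm (x - x').
  rewrite -lerBlDr; apply: lb_le_inf => // _ [y Uy <-].
  rewrite lerBlDr; apply: (@le_trans _ _ (g y + enorm (x - y))).
    by apply: ge_inf; [exact: Alb|exists y].
  by have := tri x x' y; lra.
exists (fun x => inf (A x)) => [x Ux|x y].
  apply/eqP; rewrite eq_le; apply/andP; split.
    apply: ge_inf; first exact: Alb.
    exists x => //; rewrite subrr /enorm big1 ?sqrtr0 ?addr0// => i _.
    by rewrite mxE expr0n.
  apply: lb_le_inf => // _ [y Uy <-].
  by have := gL x y Ux Uy; rewrite ler_norml => /andP[_]; lra.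
have := hlt x y; have := hlt y x; rewrite -(enormN (y - x)) opprB => h1 h2.
by rewrite ler_norml; apply/andP; split; lra.
Qed.

Lemma compact_sub_open K U : compact K -> open U -> K `<=` U ->
  exists2 r : R, 0 < r & forall x y, K x -> `|y - x| < r -> U y.
Proof.
move=> cK oU KU.
have : \forall r \near 0^'+, K `<=` (fun x => forall y, `|y - x| < r -> U y).
  move: cK => /compact_near_coveringP/(_ _ 0^'+ (fun r x => forall y, `|y - x| < r ->
    U y)); apply.
  move=> x /KU Ux.
  have /nbhs_ballP[e /= e0 xeU] : nbhs x U by exact: open_nbhs_nbhs.
  exists (ball x (e / 2), [set r | r < e / 2]).
    split => /=; first by apply: nbhsx_ballx; rewrite divr_gt0.
    by apply: nbhs_right_lt; rewrite divr_gt0.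
  move=> [x' r] /= [x'x re] y yx'; apply: xeU.
  move: x'x; rewrite -!ball_normE/= => x'x.
  have := ler_distD x' x y; rewrite (distrC x') => h; lra.
move=> H; have [r [r0 rP]] := filter_ex (filterI (nbhs_right_gt 0) H).
by exists r => // x y Kx; exact: rP.
Qed.

Definition thickening K (d : R) : set 'rV[R]_n.+1 :=
  [set x | exists2 y, K y & `|x - y| <= d].

Lemma compact_thickening K d : compact K -> compact (thickening K d).
Proof.
move=> cK.
have cB : compact [set v : 'rV[R]_n.+1 | `|v| <= d].
  apply: bounded_closed_compact.
    exists d; split; first exact: num_real.
    by move=> M dM v /= vd; rewrite (le_trans vd)// ltW.
  rewrite (_ : mkset _ = (fun v : 'rV[R]_n.+1 => `|v|) @^-1` [set t | t <= d])//.
  by apply: preimage_closed; [move=> v _; exact: norm_continuous|exact: closed_le].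
rewrite (_ : thickening K d =
    (fun p => p.1 + p.2) @` (K `*` [set v : 'rV[R]_n.+1 | `|v| <= d])).
  apply: continuous_compact; last exact: compact_setX.
  by apply: continuous_subspaceT => p; exact: add_continuous.
apply/seteqP; split=> [x [y Ky xy]|_ [[y v] [/= Ky vd] <-]].
  by exists (y, x - y) => //=; rewrite addrC subrK.
by exists y => //; rewrite addrAC subrr add0r.
Qed.

(** Otherwise U = K would be compact, and a small step from a maximum point of the first coordinate
    would stay in U and increase it. Applied to the support of f, this provides a zero of f in U. *)
Lemma compact_sub_open_vanish K U : compact K -> open U -> K `<=` U -> U !=set0 ->
  exists2 z, U z & ~ K z.
Proof.
move=> cK oU KU [u Uu]; apply: contrapT => /forall2NP h.
have UK : U `<=` K by move=> x Ux; have [//|/contrapT] := h x.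
have [c cKm cmax] : exists2 c : 'rV[R]_n.+1, c \in K & forall t :
  'rV[R]_n.+1, t \in K -> t ord0 ord0 <= c ord0 ord0.
  apply: EVT_max_rV => //; first by exists u; exact: UK.
  by apply: continuous_subspaceT; exact: continuous_coord.
move: cKm => /set_mem Kc.
have [r r0 rU] := compact_sub_open _ _ cK oU KU.
have : (c + (r / 2) *: delta_mx ord0 ord0 : 'rV[R]_n.+1) \in K.
  apply/mem_set; apply: UK; apply: (rU c) => //.
  rewrite addrAC subrr add0r (le_lt_trans (norm_scale_delta_le _ _))//.
  by rewrite gtr0_norm; lra.
by move=> /cmax; rewrite !mxE !eqxx mulr1; lra.
Qed.

End lipschitz_extension.

(** * Integration *)

Section integral_null.
Local Open Scope ereal_scope.
Context d (T : measurableType d) (R : realType).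
Variable mu : {measure set T -> \bar R}.
Import HBNNSimple.

(* No measurability of F is required: the library integral is the supremum over
   the simple functions below F, and these can be cut off on N. *)
Lemma integral_setD_null (D N : set T) (F : T -> \bar R) :
  measurable N -> mu N = 0 ->
  \int[mu]_(x in D) F x = \int[mu]_(x in D `\` N) F x.
Proof.
move=> mN N0.
suff ge0D (G : T -> \bar R) : (forall x, 0 <= G x) ->
    \int[mu]_(x in D) G x = \int[mu]_(x in D `\` N) G x.
  by rewrite [LHS]integralE [RHS]integralE !ge0D.
move=> G0; rewrite !ge0_integralE//; apply/eqP; rewrite eq_le; apply/andP; split.
  apply: ge_ereal_sup => _ [h /= hG <-].
  have mNC : measurable (~` N) by exact: measurableC.
  have hE x : proj_nnsfun h mNC x = (h x * \1_(~` N) x)%R by [].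
  apply: ereal_sup_ubound; exists (proj_nnsfun h mNC).
    move=> x; rewrite hE /patch; have := hG x; rewrite /patch indicE.
    case: (pselect (N x)) => Nx.
      rewrite (memNset (_ : ~ (~` N) x)); last by move=> /(_ Nx).
      rewrite (memNset (_ : ~ (D `\` N) x)); last by case.
      by rewrite mulr0.
    rewrite (mem_set (_ : (~` N) x))// mulr1.
    case: (pselect (D x)) => Dx; first by rewrite !mem_set.
    by rewrite !memNset//; case.
  rewrite -!integralT_nnsfun; apply: ge0_ae_eq_integral => //.
  - exact/measurable_realfun.measurable_EFinP.
  - exact/measurable_realfun.measurable_EFinP.
  - by move=> x _; rewrite lee_fin.
  - by move=> x _; rewrite lee_fin.
  exists N; split => // x hx; apply: contrapT => Nx; apply: hx => _.
  by rewrite hE indicE (mem_set (_ : (~` N) x))// mulr1.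
apply: ge_ereal_sup => _ [h /= hG <-]; apply: ereal_sup_ubound; exists h => // x.
apply: (le_trans (hG x)); rewrite /patch; case: ifPn => [/set_mem[Dx _]|_].
  by rewrite mem_set.
by case: ifPn.
Qed.

End integral_null.

Lemma continuous_measurable_rV {R : realType} {n : nat} (U : set 'rV[R]_n) (f :
  'rV[R]_n -> R) :
  open U -> (forall x, U x -> {for x, continuous f}) ->
  measurable_fun U (f : _ -> measurableTypeR R).
Proof.
move=> oU cf; apply: (measurability _ (measurable_realfun.RGenOpens.measurableE R)).
move=> _ [_ [a [b ->] <-]]; apply: open_measurable_rV.
rewrite openE => x [Ux /= fx]; rewrite /interior.
apply: filterI; first exact: open_nbhs_nbhs.
by apply: (cf x Ux); apply: open_nbhs_nbhs; split => //; exact: interval_open.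
Qed.

(** * Comparison of the variations *)

Section admissible_fields.
Context {R : realType} {n : nat}.
Implicit Types (U K : set 'rV[R]_n.+1) (f u : 'rV[R]_n.+1 -> R) (x y z : 'rV[R]_n.+1).

Lemma enorm_lipschitz (f : 'rV[R]_n.+1 -> R) :
  (forall x y, `|f x - f y| <= enorm (x - y)) -> is_lipschitz f.
Proof.
move=> fL; exists n.+1%:R => x y; apply: (le_trans (fL x y)).
exact: enorm_le_normrV.
Qed.

(** The columns are the gradients of the smoothed g^k, which are still 1-Lipschitz for the Euclidean
    norm, so every factor in [minor_sum_sqr_le] is at most 1. *)
Lemma minor_sum_le1 (h : R) (g : 'I_n -> 'rV[R]_n.+1 -> R) x : 0 < h ->
  (forall k x y, `|g k x - g k y| <= enorm (x - y)) ->
  \sum_i minor_sum (fun i k => smooth_partial h i (g k) x) i ^+ 2 <= 1.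
Proof.
move=> h0 gL; apply: (le_trans (minor_sum_sqr_le _)).
apply: prodr_ile1 => k _; apply/andP; split.
  by apply: sumr_ge0 => i _; rewrite sqr_ge0.
have gkL := enorm_lipschitz _ (gL k).
have sgL y z : `|smooth h (g k) y - smooth h (g k) z| <= enorm (y - z).
  have := steklov_shift_le h h0 double_enum (g k) (y - z) (enorm (y - z)) gkL _ z.
  rewrite (addrC z) subrK; apply => w.
  by apply: (le_trans (gL k _ _)); rewrite addrAC subrr add0r.
have := has_grad_enorm_le1 _ _ _ sgL (has_grad_smooth h h0 (g k) x gkL).
set q := \row_i _ => q1.
have : enorm q ^+ 2 <= 1 by rewrite expr_le1// enorm_ge0.
rewrite sqr_enorm; apply: le_trans.
by rewrite le_eqVlt; apply/orP; left; apply/eqP; apply: eq_bigr => i _; rewrite !mxE expr2.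
Qed.

Lemma enorm_minor_field_le1 (h : R) f (g : 'I_n -> 'rV[R]_n.+1 -> R) x : 0 < h ->
  is_lipschitz f -> (forall x, `|f x| <= 1) ->
  (forall k x y, `|g k x - g k y| <= enorm (x - y)) ->
  enorm (minor_field h f g x) <= 1.
Proof.
move=> h0 fL f1 gL.
rewrite -(@ler_pXn2r _ 2) ?nnegrE ?enorm_ge0// expr1n sqr_enorm.
have s1 : `|smooth h f x| <= 1.
  by rewrite -[smooth h f x]subr0; apply: steklov_dist => // y _; rewrite subr0.
apply: le_trans (minor_sum_le1 h g x h0 gL).
apply: ler_sum => i _; rewrite !mxE -expr2 exprMn.
rewrite ler_piMl ?sqr_ge0// -real_normK ?num_real//.
by rewrite expr_le1.
Qed.

(** The smoothed f vanishes at each point farther from K than the total reach of the averages, and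
    this reach is less than r; so the support lies in a compact thickening of K inside U. *)
Lemma minor_field_C1_c (h : R) f (g : 'I_n -> 'rV[R]_n.+1 -> R) U K (r : R) : 0 < h ->
  is_lipschitz f -> (forall k, is_lipschitz (g k)) ->
  compact K -> (forall x, f x != 0 -> K x) ->
  (forall x y, K x -> `|y - x| < r -> U y) ->
  (size (@double_enum n.+1))%:R * h < r ->
  C1_c U (minor_field h f g).
Proof.
move=> h0 fL gL cK fK KU hr; split.
- by move=> x _; exact: differentiable_minor_fieldT.
- by move=> x _; exact: continuous_jacobian_minor_field.
set d := _ * h in hr.
have cT := compact_thickening _ d cK.
have clT : closed (thickening K d) by exact: compact_closed.
have sub : closure [set x | U x /\ minor_field h f g x != 0] `<=` thickening K d.
  rewrite [X in _ `<=` X]((closure_id _).1 clT); apply: closure_subset => x [_ /= fx].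
  apply: contrapT => nK; move/negP : fx; apply; apply/eqP.
  have s0 : smooth h f x = 0.
    apply/eqP; rewrite -normr_le0 -[smooth h f x]subr0.
    apply: steklov_dist => // y yx; rewrite subr0 normr_le0.
    apply/eqP/eqP; apply: contrapT => /negP fy; apply: nK.
    by exists y; [exact: fK|rewrite distrC].
  by apply/rowP => i; rewrite !mxE s0 mul0r.
split; first by apply: subclosed_compact cT sub; exact: closed_closure.
move=> x /sub[y Ky xy]; apply: KU Ky _.
exact: le_lt_trans xy hr.
Qed.

Lemma C1_cN U (phi : 'rV[R]_n.+1 -> 'rV[R]_n.+1) : open U -> C1_c U phi -> C1_c U (- phi).
Proof.
move=> oU [dphi cphi sphi].
have dj x j : U x -> differentiable (fun y => phi y ord0 j) x.
  by move=> Ux; exact: (differentiable_component _ _ _ j (dphi x Ux)).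
have NE j : (fun y => (- phi) y ord0 j) = - (fun y => phi y ord0 j).
  by apply/funext => y; rewrite !fctE mxE.
have JN x : U x -> 'J (- phi) x = - 'J phi x.
  move=> Ux.
  apply/matrixP => i j.
  have dNj k : differentiable (fun y => (- phi) y ord0 k) x.
    by rewrite NE; apply: differentiableN; exact: dj.
  rewrite (jacobianE _ _ _ _ i j dNj).
  rewrite NE.
  rewrite deriveN; last by apply: diff_derivable; exact: dj.
  rewrite -(jacobianE _ _ _ _ i j (fun k => dj x k Ux)).
  by apply/esym; apply: mxE.
split => [x Ux|x Ux|].
- exact/differentiableN/dphi.
- apply: (near_continuous _ _ (fun y => - 'J phi y) _ _ U (open_nbhs_nbhs (conj oU Ux))).
    by move=> y Uy; rewrite JN.
  exact: (cvgN (cphi x Ux)).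
rewrite /compactly_supported (_ : [set x | _] = [set x | U x /\ phi x != 0])//.
by apply/seteqP; split=> x /= [Ux]; rewrite !fctE/= oppr_eq0.
Qed.

End admissible_fields.

Section smooth_det.
Context {R : realType} {n : nat}.
Implicit Types (U K : set 'rV[R]_n.+1) (f u : 'rV[R]_n.+1 -> R) (x y z : 'rV[R]_n.+1).
Implicit Types (g : 'I_n -> 'rV[R]_n.+1 -> R).

Definition smooth_det h f g x : R := \sum_i smooth_partial h i f x *
  minor_sum (fun i k => smooth_partial h i (g k) x) i.

Lemma continuous_smooth_det h f g : 0 < h -> is_lipschitz f ->
  (forall k, is_lipschitz (g k)) -> continuous (smooth_det h f g).
Proof.
move=> h0 fL gL; apply: continuous_bigsum => i x.
have c1 : continuous (smooth_partial h i f).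
  by apply: is_lipschitz_continuous; exact: is_lipschitz_smooth_partial.
have c2 : continuous (fun x => minor_sum (fun i k => smooth_partial h i (g k) x) i).
  apply: continuous_bigsum => s y.
  have cP : continuous (fun y => \prod_k smooth_partial h (s (lift ord0 k)) (g k) y).
    apply: continuous_bigprod => k.
    by apply: is_lipschitz_continuous; exact: is_lipschitz_smooth_partial.
  exact: (cvgM (cvg_cst ((-1) ^+ s : R)) (cP y)).
exact: (cvgM (c1 x) (c2 x)).
Qed.

(** The bound is uniform in h, so that a multiple of |u| dominates all the integrands: the partial
    derivatives of the smoothed f are at most L, and each minor is at most 1. *)
Lemma smooth_det_bound f g : is_lipschitz f ->
  (forall k x y, `|g k x - g k y| <= enorm (x - y)) ->
  exists2 B, 0 <= B & forall h x, 0 < h -> `|smooth_det h f g x| <= B.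
Proof.
move=> fL gL; have [L L0 Lf] := is_lipschitz_ge0 _ fL.
exists (\sum_(i < n.+1) L) => [|h x h0]; first exact: sumr_ge0.
apply: (le_trans (ler_norm_sum _ _ _)); apply: ler_sum => i _.
rewrite normrM -[leRHS]mulr1 ler_pM//.
  rewrite -[smooth_partial _ _ _ _]subr0; apply: steklov_dist => //.
    exact: is_lipschitz_diff_quot.
  move=> y _; rewrite subr0 /diff_quot normrM normfV (gtr0_norm h0).
  rewrite ler_pdivrMr//; apply: (le_trans (Lf _ _)); rewrite ler_wpM2l//.
  rewrite addrAC subrr add0r (le_trans (norm_scale_delta_le _ _))//.
  by rewrite gtr0_norm.
have := minor_sum_le1 h g x h0 gL.
rewrite (bigD1 i)//= => le1.
rewrite -(@expr_le1 _ 2)// real_normK ?num_real//; apply: le_trans le1.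
by rewrite lerDl; apply: sumr_ge0 => j _; rewrite sqr_ge0.
Qed.

Lemma smooth_det_cvg (h : nat -> R) f g x q (p : 'I_n -> 'rV[R]_n.+1) :
  (forall m, 0 < h m) -> h m @[m --> \oo] --> 0 ->
  is_lipschitz f -> (forall k, is_lipschitz (g k)) ->
  has_grad f x q -> (forall k, has_grad (g k) x (p k)) ->
  smooth_det (h m) f g x @[m --> \oo] -->
    \sum_i q ord0 i * minor_sum (fun i k => p k ord0 i) i.
Proof.
move=> h0 hc fL gL fq gp.
have sp_cvg (F : 'rV[R]_n.+1 -> R) (v : 'rV[R]_n.+1) i : is_lipschitz F -> has_grad F x v ->
    smooth_partial (h m) i F x @[m --> \oo] --> v ord0 i.
  move=> FL Fv; apply/cvgrPdist_le => e e0.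
  have [d d0 dP] := cvg_smooth_partial F x v i e FL Fv e0.
  move/cvgrPdist_le : hc => /(_ d d0); apply: filterS => m.
  rewrite sub0r normrN gtr0_norm// => hd.
  by rewrite distrC; exact: dP.
apply: cvg_big => [|i _]; first exact: add_continuous.
apply: cvgM; first exact: sp_cvg.
apply: cvg_big => [|s _]; first exact: add_continuous.
apply: cvgM; first exact: cvg_cst.
apply: cvg_big => [|k _]; first exact: mul_continuous.
exact: sp_cvg.
Qed.

Lemma has_grad_near f f' x q : (\forall y \near x, f y = f' y) ->
  has_grad f x q -> has_grad f' x q.
Proof.
move=> ff' fq e e0; have [d d0 dP] := fq e e0.
have /nbhs_ballP[r /= r0 rP] := ff'.
exists (Num.min d (r / 2)) => [|z]; first by rewrite lt_min d0 divr_gt0.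
rewrite le_min => /andP[zd zr]; rewrite /= -!rP; first exact: dP.
  exact: ballxx.
rewrite -ball_normE/= opprD addNKr normrN; lra.
Qed.

Lemma det_jacobian_cons_fun f g x q (p : 'I_n -> 'rV[R]_n.+1) :
  has_grad f x q -> (forall k, has_grad (g k) x (p k)) ->
  \det ('J (cons_fun f g) x) =
    \sum_i q ord0 i * minor_sum (fun i k => p k ord0 i) i.
Proof.
move=> fq gp.
have c0 : (fun y => cons_fun f g y ord0 ord0) = f.
  by apply/funext => y; rewrite mxE unlift_none.
have cS k : (fun y => cons_fun f g y ord0 (lift ord0 k)) = g k.
  by apply/funext => y; rewrite mxE liftK.
have dj j : differentiable (fun y => cons_fun f g y ord0 j) x.
  have [k ->|->] := unliftP ord0 j; rewrite ?c0 ?cS.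
    by have [] := has_grad_is_diff _ _ _ (gp k).
  by have [] := has_grad_is_diff _ _ _ fq.
have J0 i : 'J (cons_fun f g) x i ord0 = q ord0 i.
  by rewrite jacobianE// c0 (has_grad_derive _ _ _ _ fq).
have JS i k : 'J (cons_fun f g) x i (lift ord0 k) = p k ord0 i.
  by rewrite jacobianE// cS (has_grad_derive _ _ _ _ (gp k)).
rewrite det_minor_sum; apply: eq_bigr => i _; rewrite J0; congr (_ * _).
by congr minor_sum; apply/funext => j; apply/funext => k; rewrite JS.
Qed.

(** The extension by zero. A zero z of f in U gives |f x| = |f x - f z| <= 1. *)
Lemma Lip_c_extension U f : open U -> U !=set0 -> Lip_c U f -> (lip 0 U f <= 1)%E ->
  exists K r f', [/\ compact K, 0 < r, forall x y, K x -> `|y - x| < r -> U y &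
    [/\ forall x, f' x != 0 -> K x, forall x, U x -> f' x = f x,
        forall x, `|f' x| <= 1 & is_lipschitz f']].
Proof.
move=> oU U0 [/Lip_ex[L L0 fL] [cK KU]] f1.
set K := closure _ in cK KU.
have [r r0 rU] := compact_sub_open _ _ cK oU KU.
have [z Uz Kz] := compact_sub_open_vanish _ _ cK oU KU U0.
have fz : f z = 0.
  apply/eqP; apply: contrapT => /negP fz; apply: Kz.
  exact: subset_closure.
have le1 x : U x -> `|f x| <= 1.
  move=> Ux; have := lip_leP _ _ _ _ ler01 f1 x z Ux Uz.
  by rewrite fz subr0 powRr0 mulr1.
pose f' x := if x \in U then f x else 0.
have f'U x : U x -> f' x = f x by move=> Ux; rewrite /f' mem_set.
have f'NU x : ~ U x -> f' x = 0 by move=> Ux; rewrite /f' memNset.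
have f'K x : f' x != 0 -> K x.
  rewrite /f'; case: ifPn => [/set_mem Ux fx|]; last by rewrite eqxx.
  exact: subset_closure.
have f'1 x : `|f' x| <= 1.
  by rewrite /f'; case: ifPn => [/set_mem /le1//|_]; rewrite normr0.
exists K, r, f'; split => //; split => //.
(* Across the boundary of U the Lipschitz bound of f says nothing; but a nonzero value lies in K, at
   distance at least r from the complement of U, so a jump of at most 1 is at most |x - y| / r. *)
have half x y : f' x != 0 -> ~ U y -> `|f' x - f' y| <= r^-1 * `|x - y|.
  move=> /f'K Kx nUy; rewrite (f'NU y)// subr0; apply: (le_trans (f'1 x)).
  rewrite mulrC ler_pdivlMr// mul1r distrC leNgt; apply/negP => yx.
  by apply: nUy; exact: rU Kx yx.
have Lr a : 0 <= a -> r^-1 * a <= (L * n.+1%:R + r^-1) * a.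
  by move=> a0; rewrite ler_wpM2r// lerDr mulr_ge0.
have r0' : 0 <= r^-1 by rewrite invr_ge0 ltW.
exists (L * n.+1%:R + r^-1) => x y.
have [Ux|Ux] := pselect (U x); have [Uy|Uy] := pselect (U y).
- rewrite !f'U//; apply: (le_trans (fL _ _ Ux Uy)).
  apply: (@le_trans _ _ (L * (n.+1%:R * `|x - y|))).
    by rewrite ler_wpM2l// enorm_le_normrV.
  by rewrite mulrA ler_wpM2r// lerDl.
- have [fx|fx] := eqVneq (f' x) 0.
    by rewrite fx f'NU// subrr normr0 mulr_ge0// addr_ge0// mulr_ge0.
  by apply: (le_trans (half _ _ fx Uy)); exact: Lr.
- have [fy|fy] := eqVneq (f' y) 0.
    by rewrite fy f'NU// subrr normr0 mulr_ge0// addr_ge0// mulr_ge0.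
  by rewrite distrC (distrC x); apply: (le_trans (half _ _ fy Ux)); exact: Lr.
- by rewrite !f'NU// subrr normr0 mulr_ge0// addr_ge0// mulr_ge0.
Qed.

End smooth_det.

(** * The inequality V^0 <= V *)

Section varBV_lower.
Context {R : realType} {n : nat}.
Local Notation mu := (lebesgue_rV R n.+1).
Implicit Types (U : set 'rV[R]_n.+1) (u : 'rV[R]_n.+1 -> R).

Lemma integrable_mul_bounded U u (D : 'rV[R]_n.+1 -> R) (B : R) : measurable U ->
  L1 U u -> measurable_fun U (D : _ -> measurableTypeR R) ->
  (forall x, U x -> `|D x| <= B) ->
  mu.-integrable U (fun x => (u x * D x)%:E).
Proof.
move=> mU iu mD DB.
have iBu : mu.-integrable U (fun x => (B%:E * (u x)%:E)%E) by exact: integrableZl.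
have mu_ : measurable_fun U (u : _ -> measurableTypeR R).
  by apply/measurable_realfun.measurable_EFinP; exact: measurable_int iu.
apply: le_integrable iBu => //.
  apply/measurable_realfun.measurable_EFinP.
  exact: measurable_realfun.measurable_funM.
move=> x Ux /=; rewrite lee_fin mulrC !normrM ler_wpM2r//.
by rewrite (le_trans (DB x Ux))// ler_norm.
Qed.

(** [varBV] is a supremum without absolute value, so both phi and -phi are tested; integrability
    lets the sign pass through the integral. *)
Lemma varBV_pm U u phi : open U -> C1_c U phi ->
  (forall x, U x -> enorm (phi x) <= 1) ->
  mu.-integrable U (fun x => (u x * divergence phi x)%:E) ->
  (`| \int[mu]_(x in U) (u x * divergence phi x)%:E | <= varBV U u)%E.
Proof.
move=> oU Cphi phi1 iphi.
have h1 : (\int[mu]_(x in U) (u x * divergence phi x)%:E <= varBV U u)%E.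
  by apply: ereal_sup_ubound; exists phi.
have h2 : (- (\int[mu]_(x in U) (u x * divergence phi x)%:E) <= varBV U u)%E.
  have -> : (- (\int[mu]_(x in U) (u x * divergence phi x)%:E) =
      \int[mu]_(x in U) (u x * divergence (- phi) x)%:E)%E.
    rewrite -mulN1e -(integralZl (open_measurable_rV _ oU) iphi (-1)).
    apply: eq_integral => x /set_mem Ux; rewrite -EFinM; congr (_%:E).
    rewrite mulN1r -mulrN; congr (_ * _).
    rewrite /divergence -sumrN; apply: eq_bigr => i _.
    have NE : (fun y => (- phi) y ord0 i) = - (fun y => phi y ord0 i).
      by apply/funext => y; rewrite !fctE mxE.
    rewrite NE deriveN//; apply: diff_derivable.
    have [dphi _ _] := Cphi.
    exact: (differentiable_component _ _ _ i (dphi x Ux)).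
  apply: ereal_sup_ubound; exists (- phi); last by [].
  split; first exact: C1_cN.
  by move=> x Ux; rewrite fctE enormN; exact: phi1.
have [i0|i0] := leP 0%E (\int[mu]_(x in U) (u x * divergence phi x)%:E)%E.
  by rewrite gee0_abs.
by rewrite lte0_abs.
Qed.

Lemma varBValpha0_le U u : open U -> L1 U u -> (varBValpha 0 U u <= varBV U u)%E.
Proof.
move=> oU iu; have mU := open_measurable_rV _ oU.
apply: ge_ereal_sup => _ [[f g] /= [Lf Lg f1 g1] <-].
(* The extensions of f and of the g^k both need a point of U, so the empty set is treated apart,
   with the zero field. *)
have [->|U0] := eqVneq U set0.
  rewrite integral_set0 abse0; apply: ereal_sup_ubound.
  exists 0; last by rewrite integral_set0.
  split; last by [].
  split; [by []|by []|].
  rewrite /compactly_supported (_ : [set x | _] = set0) ?closure0.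
    by split => //; exact: compact0.
  by rewrite -subset0 => x [].
have {}U0 : U !=set0 by apply/set0P.
have [K [r [f' [cK r0 KU [f'K f'U f'1 f'L]]]]] := Lip_c_extension U f oU U0 Lf f1.
have [z Uz] := U0.
have /choice[g' g'P] : forall k, exists g' : 'rV[R]_n.+1 -> R,
    (forall x, U x -> g' x = g k x) /\ forall x y, `|g' x - g' y| <= enorm (x - y).
  move=> k; have [g' ? ?] := mcshane U (g k) z Uz (lip1_leP _ _ (g1 k)).
  by exists g'.
have g'L k : is_lipschitz (g' k) by apply: enorm_lipschitz; case: (g'P k).
have [B B0 BP] := smooth_det_bound f' g' f'L (fun k => (g'P k).2).
pose N : R := (size (@double_enum n.+1))%:R.
(* The factor r / (N + 1) ensures N h < r for every m, as [minor_field_C1_c] requires. *)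
pose h (m : nat) : R := r / (N + 1) * m.+1%:R^-1.
have N0 : 0 <= N by rewrite ler0n.
have rN : 0 < r / (N + 1) by rewrite divr_gt0// ltr_wpDl.
have h0 m : 0 < h m by rewrite mulr_gt0// invr_gt0.
have hr m : N * h m < r.
  rewrite (@le_lt_trans _ _ (N * (r / (N + 1))))//.
    by rewrite ler_wpM2l// /h ger_pMr// invf_le1// ler1n.
  by rewrite mulrA ltr_pdivrMr ?ltr_wpDl// mulrC ltr_pM2l// ltrDl.
have hc : h m @[m --> \oo] --> 0.
  by rewrite -(mulr0 (r / (N + 1)));
    exact: (cvgM (cvg_cst (r / (N + 1))) (@cvg_harmonic R)).
have [L fL] := f'L.
have [N1 [mN1 N10 N1P]] := rademacher _ _ fL.
have {}N1P x : ~ N1 x -> exists q, has_grad f' x q.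
  by move=> nx; apply: contrapT => nq; apply: nx; exact: N1P.
have N2_neg : mu.-negligible (\bigcup_k [set x | ~ exists p, has_grad (g' k) x p]).
  apply: negligible_bigcup_count => k; have [M gM] := g'L k.
  exact: rademacher gM.
have [N2 [mN2 N20 N2P]] := N2_neg.
have {}N2P x : ~ N2 x -> forall k, exists p, has_grad (g' k) x p.
  by move=> nx k; apply: contrapT => nq; apply: nx; apply: N2P; exists k.
pose NN := N1 `|` N2.
have mNN : measurable NN by exact: measurableU.
have NN0 : mu NN = 0 by apply: null_set_setU.
(* The null set is removed before anything is known about the measurability of the Jacobian
   determinant; off it, the determinant is a pointwise limit of continuous functions. *)
rewrite (integral_setD_null _ _ _ _ _ _ _ mNN NN0).
pose D m := smooth_det (h m) f' g'.
have mD m : measurable_fun U (D m : _ -> measurableTypeR R).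
  by apply: continuous_measurable_rV => // x _; exact: continuous_smooth_det.
have iD m : mu.-integrable U (fun x => (u x * D m x)%:E).
  by apply: (integrable_mul_bounded _ _ _ B) => // x _; exact: BP.
have Dm m : (`| \int[mu]_(x in U `\` NN) (u x * D m x)%:E | <= varBV U u)%E.
  rewrite -(integral_setD_null _ _ _ _ _ _ _ mNN NN0).
  have divE x : divergence (minor_field (h m) f' g') x = D m x.
    exact: divergence_minor_field.
  have fE : (fun x => (u x * divergence (minor_field (h m) f' g') x)%:E) =
      (fun x => (u x * D m x)%:E).
    by apply/funext => x; rewrite divE.
  rewrite -fE; apply: varBV_pm => //.
  - exact: (minor_field_C1_c _ _ _ _ _ _ (h0 m) f'L g'L cK f'K KU (hr m)).
  - by move=> x _; apply: enorm_minor_field_le1 => // k; case: (g'P k).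
  - by rewrite fE; exact: iD.
have mUN : measurable (U `\` NN) by exact: measurableD.
have cvgD : (\int[mu]_(x in U `\` NN) (u x * D m x)%:E)%E @[m --> \oo] -->
    (\int[mu]_(x in U `\` NN) (u x * \det ('J (cons_fun f g) x))%:E)%E.
  apply: (@dominated_cvg _ _ _ _ _ mUN _ _ (fun x => (B%:E * (`|u x|)%:E)%E)) => //.
  - by move=> m; apply: measurable_int (integrableS mU mUN (@subDsetl _ _ _) (iD m)).
  - move=> x [Ux /not_orP[x1 x2]].
    apply: cvg_EFin; first exact: nearW.
    have [q fq] := N1P x x1; have /choice[p gp] := N2P x x2.
    have nU : nbhs x U by exact: open_nbhs_nbhs.
    rewrite (det_jacobian_cons_fun f g x q p).
    + exact: (cvgM (cvg_cst (u x)) (smooth_det_cvg h f' g' x q p h0 hc f'L g'L fq gp)).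
    + by apply: has_grad_near fq; apply: filterS nU => y /f'U.
    + by move=> k; apply: has_grad_near (gp k); apply: filterS nU => y /(g'P k).1.
  - apply: integrableZl => //; apply: (integrableS mU mUN (@subDsetl _ _ _)).
    exact: integrable_norm.
  - move=> m x _; rewrite /= lee_fin normrM mulrC ler_wpM2r//.
    exact: BP.
by apply: cvge_le (cvg_abse cvgD); exact: nearW.
Qed.

End varBV_lower.

(** * The inequality V <= 2n V^0 *)

Lemma near_differentiable {R : realType} (V W : normedModType R) (f g : V -> W) (x : V) :
  (\forall y \near x, f y = g y) -> differentiable f x -> differentiable g x.
Proof.
move=> fg df; have [cd /eqaddoP fo] := (diff_locallyP x f).1 df.
suff : is_diff x g ('d f x) by case.
apply: is_diff_near => // e e0.
have sh : (fun z : V => z + x) @ nbhs (0 : V) --> x.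
  rewrite -[X in _ --> X]add0r.
  exact: (cvgD (@cvg_id _ (nbhs (0 : V))) (cvg_cst x)).
apply: filterS2 (fo e e0) (sh _ fg) => z; rewrite !fctE/= => h <-.
by rewrite -(nbhs_singleton fg) -addrA -opprD.
Qed.

Section compact_fields.
Context {R : realType} {n : nat}.
Implicit Types (U K : set 'rV[R]_n.+1) (f : 'rV[R]_n.+1 -> R) (x y z v : 'rV[R]_n.+1).
Local Notation e_ i := (delta_mx ord0 i : 'rV[R]_n.+1).

Lemma is_derive_line f x v (t : R) : differentiable f (x + t *: v) ->
  is_derive t 1 (fun s => f (x + s *: v)) ('d f (x + t *: v) v).
Proof.
move=> df; pose l := (cst x : R -> 'rV[R]_n.+1) + *:%R^~ v.
have dl : is_diff t l ( *:%R^~ v : R -> 'rV[R]_n.+1).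
  rewrite -[X in is_diff _ _ X]add0r; exact: is_diffD.
have dfl : differentiable f (l t) by exact: df.
have h := is_diff_comp dl (differentiableP dfl).
have hE : f \o l = (fun s => f (x + s *: v)) by [].
rewrite -hE; apply: DeriveDef; first by apply: diff_derivable; case: h.
by rewrite deriveE; [rewrite diff_val /= scale1r|case: h].
Qed.

Lemma bounded_diff_lipschitz f (C : R) : (forall x, differentiable f x) ->
  (forall x i, `|'D_(e_ i) f x| <= C) ->
  forall x y, `|f x - f y| <= n.+1%:R * C * `|x - y|.
Proof.
move=> df dC x y.
have C0 : 0 <= C by apply: le_trans (dC 0 ord0).
pose v := x - y.
have dl (t : R) : is_derive t 1 (fun t => f (y + t *: v)) ('d f (y + t *: v) v).
  exact: is_derive_line.
have cl : {within `[0, 1], continuous (fun t : R => f (y + t *: v))}.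
  by apply: derivable_within_continuous => t _; have [] := dl t.
have [c _] := @MVT_segment R (fun t => f (y + t *: v)) (fun t => 'd f (y + t *: v) v) 0
  1 ler01 (fun t _ => dl t) cl.
rewrite scale1r scale0r addr0 subr0 mulr1 [y + v](_ : _ = x) => [->|];
  last by rewrite /v addrC subrK.
rewrite -[X in 'd f _ X](row_sum_scale_delta v) linear_sum.
apply: (le_trans (ler_norm_sum _ _ _)).
rewrite -mulrA mulr_natl -[X in _ *+ X]card_ord -sumr_const.
apply: ler_sum => i _; rewrite linearZ/= -deriveE// normrM mulrC.
by rewrite ler_pM// normrV_coord.
Qed.

Lemma C1_c_jacobian_bound U phi : open U -> C1_c U phi ->
  exists C, forall x i j, U x -> `|'J phi x i j| <= C.
Proof.
move=> oU [dphi cphi [cK KU]]; set K := closure _ in cK KU.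
have cJ x i j : U x -> {for x, continuous (fun y => 'J phi y i j)}.
  move=> Ux; have cx := cphi x Ux.
  apply: (cvg_comp _ (fun M : 'M[R]_n.+1 => M i j) cx).
  exact: differentiable_continuous (differentiable_coord _ _ _).
have bK i j : exists C, forall x, K x -> `|'J phi x i j| <= C.
  have [[k Kk]|nK] := pselect (K !=set0); last first.
    by exists 0 => x Kx; exfalso; apply: nK; exists x.
  have [|c _ cmax] := @EVT_max_rV R n.+1 (fun x => `|'J phi x i j|) K (ex_intro _ k Kk) cK.
    apply: continuous_in_subspaceT => x /set_mem Kx.
    exact: (cvg_norm (cJ x i j (KU x Kx))).
  by exists (`|'J phi c i j|) => x Kx; apply: cmax; exact: mem_set.
have /choice[C CP] : forall ij : 'I_n.+1 * 'I_n.+1, exists C, forall x, K x ->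
  `|'J phi x ij.1 ij.2| <= C.
  by move=> [i j]; exact: bK.
exists (\sum_ij `|C ij|) => x i j Ux.
have [Kx|Kx] := pselect (K x).
  apply: (le_trans (CP (i, j) x Kx)); apply: (le_trans (ler_norm _)).
  by rewrite (bigD1 (i, j))//= lerDl; exact: sumr_ge0.
(* Outside the support K the field vanishes on a whole neighborhood of x. *)
have -> : 'J phi x i j = 0.
  rewrite jacobianE => [|k]; last first.
    exact: (differentiable_component _ _ _ k (dphi x Ux)).
  have oUK : open (U `&` ~` K).
    by apply: openI => //; apply: closed_openC; exact: closed_closure.
  rewrite -(@derive_cst _ _ _ (0 : R) x (e_ i)); apply: near_eq_derive.
  have nUK : nbhs x (U `&` ~` K) by exact: open_nbhs_nbhs.
  apply: filterS nUK => y [Uy Ky] /=.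
  suff -> : phi y = 0 by rewrite mxE.
  by apply: contrapT => py; apply: Ky; apply: subset_closure; split => //; apply/eqP.
by rewrite normr0; exact: sumr_ge0.
Qed.

(** Segments between points of U may leave U, so the mean value inequality is applied to the
    extension by zero. It is differentiable everywhere: a point outside U has a neighborhood that
    misses the support. *)
Lemma C1_c_component_lipschitz U phi i : open U -> C1_c U phi ->
  exists2 C, 0 <= C & forall x y, U x -> U y ->
    `|phi x ord0 i - phi y ord0 i| <= C * `|x - y|.
Proof.
move=> oU Cphi; have [C CP] := C1_c_jacobian_bound U phi oU Cphi.
have [dphi cphi [cK KU]] := Cphi; set K := closure _ in cK KU.
have dj x j : U x -> differentiable (fun y => phi y ord0 j) x.
  by move=> Ux; exact: (differentiable_component _ _ _ j (dphi x Ux)).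
pose F x := if x \in U then phi x ord0 i else 0.
have FU x : U x -> F x = phi x ord0 i by move=> Ux; rewrite /F mem_set.
have dF x : differentiable F x /\ forall j, `|'D_(e_ j) F x| <= `|C|.
  have [Ux|Ux] := pselect (U x).
    have nU : nbhs x U by exact: open_nbhs_nbhs.
    have nF : \forall y \near x, phi y ord0 i = F y by apply: filterS nU => y /FU.
    split; first exact: near_differentiable nF (dj x i Ux).
    move=> j; rewrite -(near_eq_derive _ nF) -jacobianE.
      by apply: (le_trans (CP x j i Ux)); exact: ler_norm.
    by move=> k; exact: dj.
  have oK : open (~` K) by apply: closed_openC; exact: closed_closure.
  have nK : nbhs x (~` K) by apply: open_nbhs_nbhs; split => // /KU.
  have nF : \forall y \near x, cst 0 y = F y.
    apply: filterS nK => y Ky; rewrite /F; case: ifPn => // /set_mem Uy.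
    suff -> : phi y = 0 by rewrite mxE.
    by apply: contrapT => py; apply: Ky; apply: subset_closure; split => //; apply/eqP.
  split; first by apply: near_differentiable nF _; exact: differentiable_cst.
  by move=> j; rewrite -(near_eq_derive _ nF) derive_cst normr0.
exists (n.+1%:R * `|C|) => [|x y Ux Uy]; first by rewrite mulr_ge0.
rewrite -!FU//; apply: bounded_diff_lipschitz => z; first by have [] := dF z.
by move=> j; have [_] := dF z; exact.
Qed.

End compact_fields.

Section varBV_upper.
Context {R : realType} {n : nat}.
Local Notation mu := (lebesgue_rV R n.+1).
Implicit Types (U : set 'rV[R]_n.+1) (u f : 'rV[R]_n.+1 -> R) (x y : 'rV[R]_n.+1).
Local Notation e_ i := (delta_mx ord0 i : 'rV[R]_n.+1).

Lemma lip_le (a L : R) U f :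
  (forall x y, U x -> U y -> `|f x - f y| <= L * enorm (x - y) `^ a) ->
  (lip a U f <= L%:E)%E.
Proof.
move=> fL; apply: ge_ereal_sup => _ [[x y] /= [Ux Uy xy] <-].
have e0 : 0 < enorm (x - y).
  by rewrite (lt_le_trans _ (normrV_le_enorm _))// normr_gt0 subr_eq0.
by rewrite lee_fin ler_pdivrMr ?powR_gt0//; exact: fL.
Qed.

Definition other_coord (i : 'I_n.+1) (k : 'I_n) (x : 'rV[R]_n.+1) : R :=
  x ord0 (lift i k).

Lemma lip_other_coord U i k : (lip 1 U (other_coord i k) <= 1)%E.
Proof.
apply: (lip_le 1 1) => x y _ _; rewrite mul1r powRr1 ?enorm_ge0//.
apply: le_trans (normrV_le_enorm _).
by have := normrV_coord (x - y) (lift i k); rewrite !mxE.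
Qed.

(** The other coordinates do not depend on the i-th one, so row i is zero except in its first entry;
    deleting this row and the first column leaves the identity. *)
Lemma det_jacobian_other_coord f i x : differentiable f x ->
  \det ('J (cons_fun f (other_coord i)) x) = (-1) ^+ i * 'D_(e_ i) f x.
Proof.
move=> df.
have c0 : (fun y => cons_fun f (other_coord i) y ord0 ord0) = f.
  by apply/funext => y; rewrite mxE unlift_none.
have cS k : (fun y => cons_fun f (other_coord i) y ord0 (lift ord0 k)) = other_coord i k.
  by apply/funext => y; rewrite mxE liftK.
have dg k : differentiable (other_coord i k) x by exact: differentiable_coord.
have dj j : differentiable (fun y => cons_fun f (other_coord i) y ord0 j) x.
  by have [k ->|->] := unliftP ord0 j; rewrite ?c0 ?cS.
have Dg j k : 'D_(e_ j) (other_coord i k) x = (j == lift i k)%:R.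
  have gq : has_grad (other_coord i k) x (e_ (lift i k)).
    move=> e e0; exists 1 => // z _.
    rewrite (_ : _ - _ = 0) ?normr0 ?mulr_ge0 ?(ltW e0)//.
    suff -> : dot (e_ (lift i k)) z = z ord0 (lift i k).
      by rewrite /other_coord /= mxE addrAC addrK subrr.
    rewrite -[RHS]mulr1 -dot_delta scale1r.
    by apply: eq_bigr => l _; rewrite mulrC.
  by rewrite (has_grad_derive _ _ _ _ gq) mxE eqxx/=.
set M := 'J _ _.
have MS j k : M j (lift ord0 k) = (j == lift i k)%:R by rewrite /M jacobianE// cS.
have M0 : M i ord0 = 'D_(e_ i) f x by rewrite /M jacobianE// c0.
rewrite (expand_det_row M i) (bigD1 ord0)//= big1 => [|j j0]; last first.
  have [k jk|jj] := unliftP ord0 j; last by rewrite jj eqxx in j0.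
  by rewrite jk [X in X * _](MS i k) (negbTE (neq_lift _ _)) mul0r.
rewrite addr0 M0 mulrC /cofactor addn0 [X in \det X](_ : _ = 1%:M) ?det1 ?mulr1//.
apply/matrixP => a b; rewrite [RHS]mxE -(inj_eq (@lift_inj _ i)) -MS.
by rewrite [LHS]mxE [LHS]mxE.
Qed.

Lemma component_integral_le U u phi i : open U -> L1 U u -> C1_c U phi ->
  (forall x, U x -> enorm (phi x) <= 1) ->
  (`| \int[mu]_(x in U) (u x * 'J phi x i i)%:E | <= 2%:E * varBValpha 0 U u)%E.
Proof.
move=> oU iu Cphi phi1.
have mU := open_measurable_rV _ oU.
have [dphi cphi [cK KU]] := Cphi.
(* Since |phi_i| <= 1 on U, halving brings the oscillation down to 1 and makes f admissible; this is
   the origin of the factor 2. *)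
pose f x := 2^-1 * phi x ord0 i.
have dj x j : U x -> differentiable (fun y => phi y ord0 j) x.
  by move=> Ux; exact: (differentiable_component _ _ _ j (dphi x Ux)).
have [C C0 phiC] := C1_c_component_lipschitz U phi i oU Cphi.
have le1 x : U x -> `|phi x ord0 i| <= 1.
  move=> Ux; apply: (le_trans (normrV_coord _ _)).
  by apply: (le_trans (normrV_le_enorm _)); exact: phi1.
have Lf : Lip_c U f.
  split.
    apply: (@le_lt_trans _ _ (C)%:E); last exact: ltry.
    apply: lip_le => x y Ux Uy; rewrite powRr1 ?enorm_ge0// -mulrBr normrM ger0_norm//.
    apply: (@le_trans _ _ (C * `|x - y|)); last by rewrite ler_wpM2l// normrV_le_enorm.
    by have := phiC x y Ux Uy; have := normr_ge0 (phi x ord0 i - phi y ord0 i); lra.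
  have sub : closure [set x | U x /\ f x != 0] `<=` closure [set x | U x /\ phi x != 0].
    apply: closure_subset => x [Ux fx]; split => //.
    by apply: contra fx => /eqP p0; rewrite /f p0 mxE mulr0.
  split; first by apply: subclosed_compact cK sub; exact: closed_closure.
  by move=> x /sub /KU.
have f1 : (lip 0 U f <= 1)%E.
  apply: (lip_le 0 1) => x y Ux Uy; rewrite powRr0 mulr1 -mulrBr normrM ger0_norm//.
  have := ler_normB (phi x ord0 i) (phi y ord0 i).
  by have := le1 x Ux; have := le1 y Uy; lra.
have V0 : (`| \int[mu]_(x in U) (u x * \det ('J (cons_fun f (other_coord i)) x))%:E |
    <= varBValpha 0 U u)%E.
  apply: ereal_sup_ubound; exists (f, other_coord i) => //; split => //=.
    by move=> k; apply: (le_lt_trans (lip_other_coord U i k)); exact: ltry.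
  by move=> k; exact: lip_other_coord.
have [B BP] := C1_c_jacobian_bound U phi oU Cphi.
have mJ : measurable_fun U ((fun x => 'J phi x i i) : _ -> measurableTypeR R).
  apply: continuous_measurable_rV => // x Ux; have cx := cphi x Ux.
  apply: (cvg_comp _ (fun M : 'M[R]_n.+1 => M i i) cx).
  exact: differentiable_continuous (differentiable_coord _ _ _).
have iJ : mu.-integrable U (fun x => (u x * 'J phi x i i)%:E).
  by apply: (integrable_mul_bounded _ _ _ B) => // x Ux; exact: BP.
have detE x : U x -> \det ('J (cons_fun f (other_coord i)) x) =
    (-1) ^+ i / 2 * 'J phi x i i.
  move=> Ux; have df : differentiable f x.
    apply: (@differentiableM _ _ (cst _)); [exact: differentiable_cst|exact: dj].
  rewrite det_jacobian_other_coord// -mulrA; congr (_ * _).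
  rewrite jacobianE; last by move=> k; exact: dj.
  by rewrite /f deriveMl//; apply: diff_derivable; exact: dj.
have E : (\int[mu]_(x in U) (u x * \det ('J (cons_fun f (other_coord i)) x))%:E =
    ((-1) ^+ i / 2)%:E * \int[mu]_(x in U) (u x * 'J phi x i i)%:E)%E.
  rewrite -integralZl//; apply: eq_integral => x /set_mem Ux.
  by rewrite detE// -EFinM mulrCA.
move: V0; rewrite E abseM /= normrM normrX normrN1 expr1n mul1r ger0_norm//.
by rewrite lee_pdivrMl.
Qed.

Lemma varBV_le U u : open U -> L1 U u ->
  (varBV U u <= (2 * n.+1)%:R%:E * varBValpha 0 U u)%E.
Proof.
move=> oU iu; have mU := open_measurable_rV _ oU.
apply: ge_ereal_sup => _ [phi [Cphi phi1] <-].
have [dphi cphi _] := Cphi.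
have [B BP] := C1_c_jacobian_bound U phi oU Cphi.
have iJ i : mu.-integrable U (fun x => (u x * 'J phi x i i)%:E).
  apply: (integrable_mul_bounded _ _ _ B) => //; last by move=> x Ux; exact: BP.
  apply: continuous_measurable_rV => // x Ux; have cx := cphi x Ux.
  apply: (cvg_comp _ (fun M : 'M[R]_n.+1 => M i i) cx).
  exact: differentiable_continuous (differentiable_coord _ _ _).
have -> : (\int[mu]_(x in U) (u x * divergence phi x)%:E =
    \sum_i \int[mu]_(x in U) (u x * 'J phi x i i)%:E)%E.
  rewrite -integral_sum//; apply: eq_integral => x /set_mem Ux.
  rewrite sumEFin -mulr_sumr; congr (_ * _)%:E; apply: eq_bigr => i _.
  rewrite jacobianE// => j.
  exact: (differentiable_component _ _ _ j (dphi x Ux)).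
apply: (@le_trans _ _ (\sum_(i < n.+1) (2%:E * varBValpha 0 U u))%E).
  apply: lee_sum => i _; apply: (le_trans (lee_abs _)).
  exact: component_integral_le.
(* The variation may be +oo, and its nonnegativity is what allows the product to distribute over the
   n + 1 summands; it is read off from the bound on an absolute value. *)
have c0 : (0 <= 2%:E * varBValpha 0 U u)%E.
  exact: le_trans (abse_ge0 _) (component_integral_le _ _ _ ord0 oU iu Cphi phi1).
rewrite mulnC natrM EFinM -muleA; set c := (2%:E * _)%E in c0 *.
rewrite le_eqVlt; apply/orP; left; apply/eqP.
elim: (n.+1) => [|m IH]; first by rewrite big_ord0 mul0e.
by rewrite big_ord_recr/= IH -natr1 EFinD ge0_muleDl ?lee_fin// mul1e.
Qed.

End varBV_upper.

(* The dimension of the space is n.+1, i.e. an arbitrary integer >= 1. *)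
Theorem lemma3p1 (R : realType) (n : nat) (U : set 'rV[R]_n.+1)
    (oU : open U) :
  BV U = BValpha 0 U /\
  forall u : 'rV[R]_n.+1 -> R, L1 U u ->
    (varBValpha 0 U u <= varBV U u)%E /\
    (varBV U u <= (2 * n.+1)%:R%:E * varBValpha 0 U u)%E.
Proof.
have h u : L1 U u -> (varBValpha 0 U u <= varBV U u)%E /\
    (varBV U u <= (2 * n.+1)%:R%:E * varBValpha 0 U u)%E.
  by move=> iu; split; [exact: varBValpha0_le|exact: varBV_le].
split=> //; apply/seteqP; split=> u [iu Vu]; split=> //; have [h1 h2] := h u iu.
  exact: le_lt_trans h1 Vu.
apply: (le_lt_trans h2); rewrite lte_mul_pinfty// ?lee_fin//.

Qed.
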